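(* Let $z>y\ge1$ be integers and $0\le\alpha<1$ be such that the $(\alpha,z,y)$-Johnson Coverage$^*$ problem is NP-hard. Then for every constant $\varepsilon>0$ there is a constant $\rho>0$ such that, given as input a point-set $\mathcal{P}\subset\{0,1\}^d$ of size $n$ (with $d=O(\log n)$) and a parameter $k$, it is NP-hard to distinguish between the following two cases: - Completeness: there exist $\mathcal{C}'=\{c_1,\dots,c_k\}\subseteq\mathbb{R}^d$ and $\sigma:\mathcal{P}\to\mathcal{C}'$ such that $\sum_{a\in\mathcal{P}}\|a-\sigma(a)\|_1\le\rho\, n\log n$. - Soundness: for every $\mathcal{C}'=\{c_1,\dots,c_k\}\subseteq\mathbb{R}^d$ and every $\sigma:\mathcal{P}\to\mathcal{C}'$, $\sum_{a\in\mathcal{P}}\|a-\sigma(a)\|_1\ge\left(1+\frac{1-\alpha}{z-y}-\varepsilon\right)\cdot\rho\, n\log n$.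
   Context: $(\alpha,z,y)$-Johnson Coverage problem ($z>y\ge1$): given a universe $U=[n]=\{1,\dots,n\}$, a collection $E\subseteq\binom{[n]}{z}$ of $z$-element subsets, and a parameter $k$, distinguish between: (Completeness) there are $S_1,\dots,S_k\in\binom{[n]}{y}$ such that every $T\in E$ contains some $S_i$; (Soundness) for all $S_1,\dots,S_k\in\binom{[n]}{y}$, the number of $T\in E$ containing at least one $S_i$ is at most $\alpha|E|$. The $(\alpha,z,y)$-Johnson Coverage$^*$ problem is its special case restricted to instances satisfying $|E|=\omega(k\cdot|U|^{z-y-1})$. *)

(* Defs.v *)
From HB Require Import structures.
From mathcomp Require Import all_boot all_order all_algebra.
From mathcomp Require Import reals exp.

Set Implicit Arguments.
Unset Strict Implicit.
Unset Printing Implicit Defensive.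

Import Order.TTheory GRing.Theory Num.Theory.
Local Open Scope ring_scope.

(* Tape symbols are 0, 1 and the blank [None]. *)
Notation symbol := (option bool).

Inductive move := MoveL | Stay | MoveR.

(* A two-way infinite tape.  [tright] starts at the scanned cell, [tleft]
   lists the cells to its left, nearest first; cells not listed are blank. *)
Record tape := Tape { tleft : seq symbol; tright : seq symbol }.

Definition tape_read (t : tape) : symbol := head None (tright t).

Definition tape_act (t : tape) (a : symbol * move) : tape :=
  match a.2 with
  | MoveL =>
      Tape (behead (tleft t))
           (head None (tleft t) :: a.1 :: behead (tright t))
  | Stay => Tape (tleft t) (a.1 :: behead (tright t))
  | MoveR => Tape (a.1 :: tleft t) (behead (tright t))
  end.

Record TM := {
  TM_tapes : nat; (* number of tapes besides the input/output tape [ord0] *)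
  TM_state : finType;
  TM_start : TM_state;
  TM_halt : pred TM_state;
  TM_delta : TM_state -> {ffun 'I_TM_tapes.+1 -> symbol} ->
             TM_state * ('I_TM_tapes.+1 -> symbol * move)
}.

Definition TM_config (M : TM) : Type :=
  TM_state M * {ffun 'I_(TM_tapes M).+1 -> tape}.

Definition TM_init (M : TM) (x : seq bool) : TM_config M :=
  (TM_start M,
   [ffun i => if i == ord0 then Tape [::] (map Some x) else Tape [::] [::]]).

Definition TM_step (M : TM) (c : TM_config M) : TM_config M :=
  if TM_halt c.1 then c else
  let qa := TM_delta c.1 [ffun i => tape_read (c.2 i)] in
  (qa.1, [ffun i => tape_act (c.2 i) (qa.2 i)]).

(* The output is read on tape [ord0], from the head up to the first blank. *)
Fixpoint bits_until_blank (s : seq symbol) : seq bool :=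
  if s is Some b :: s' then b :: bits_until_blank s' else [::].

Definition TM_output (M : TM) (c : TM_config M) : seq bool :=
  bits_until_blank (tright (c.2 ord0)).

Definition poly_bound (c m : nat) : nat := (c * m ^ c + c)%N.

(* [TM_step] fixes halted configurations, so this says that the machine halts
   with output [f x] after at most [poly_bound c (size x)] steps. *)
Definition poly_time (f : seq bool -> seq bool) : Prop :=
  exists (M : TM) (c : nat), forall x : seq bool,
    let cf := iter (poly_bound c (size x)) (@TM_step M) (TM_init M x) in
    TM_halt cf.1 /\ TM_output cf = f x.

(* Self-delimiting pairing: the bits of [x] doubled, then 01, then [w]. *)
Definition pair_bits (x w : seq bool) : seq bool :=
  flatten [seq [:: b; b] | b <- x] ++ [:: false; true] ++ w.

Definition in_NP (L : seq bool -> Prop) : Prop :=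
  exists (V : seq bool -> seq bool) (c : nat), poly_time V /\
    forall x, L x <->
      exists w, (size w <= poly_bound c (size x))%N /\
                V (pair_bits x w) = [:: true].

Record promise_problem := PromiseProblem {
  yes_instance : seq bool -> Prop;
  no_instance : seq bool -> Prop
}.

(* Hardness under deterministic polynomial-time many-one reductions. *)
Definition NP_hard (A : promise_problem) : Prop :=
  forall L : seq bool -> Prop, in_NP L ->
  exists f : seq bool -> seq bool, poly_time f /\
    forall x, (L x -> yes_instance A (f x)) /\ (~ L x -> no_instance A (f x)).

Definition unary (m : nat) : seq bool := rcons (nseq m true) false.

(* [E] must be nonempty: for [E] empty, completeness and soundness hold
   simultaneously. *)
Definition johnson_wf (z n k : nat) (E : seq {set 'I_n}) : Prop :=
  [/\ (0 < k)%N, (0 < size E)%N, uniq E & forall T, T \in E -> #|T| = z].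

Definition johnson_encode (n k : nat) (E : seq {set 'I_n}) : seq bool :=
  unary n ++ unary k ++ flatten [seq [seq i \in T | i <- enum 'I_n] | T : {set 'I_n} <- E].

Definition covers (n k : nat) (S : 'I_k -> {set 'I_n}) (T : {set 'I_n}) : bool :=
  [exists i, S i \subset T].

Definition johnson_complete (y n k : nat) (E : seq {set 'I_n}) : Prop :=
  exists S : 'I_k -> {set 'I_n},
    (forall i, #|S i| = y) /\ (forall T, T \in E -> covers S T).

Definition johnson_sound (R : realType) (alpha : R) (y n k : nat)
    (E : seq {set 'I_n}) : Prop :=
  forall S : 'I_k -> {set 'I_n}, (forall i, #|S i| = y) ->
    (count (covers S) E)%:R <= alpha * (size E)%:R.

Definition johnson_coverage (R : realType) (alpha : R) (z y : nat)
    (side : nat -> nat -> nat -> Prop) : promise_problem :=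
  PromiseProblem
    (fun x => exists (n k : nat) (E : seq {set 'I_n}),
       [/\ johnson_wf z k E, side n k (size E), x = johnson_encode k E
         & johnson_complete y k E])
    (fun x => exists (n k : nat) (E : seq {set 'I_n}),
       [/\ johnson_wf z k E, side n k (size E), x = johnson_encode k E
         & johnson_sound alpha y k E]).

Definition tends_to_infinity (h : nat -> nat) : Prop :=
  forall B : nat, exists N : nat, forall m : nat, (N <= m)%N -> (B <= h m)%N.

(* |E| = omega(k |U|^(z-y-1)), with [h] the diverging lower bound on the
   ratio, as a function of |U|. *)
Definition johnson_coverage_star (R : realType) (alpha : R) (z y : nat)
    (h : nat -> nat) : promise_problem :=
  johnson_coverage alpha z y
    (fun n k e => (h n * (k * n ^ (z - y - 1)) <= e)%N).

Definition johnson_coverage_star_NP_hard (R : realType) (alpha : R)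
    (z y : nat) : Prop :=
  exists h : nat -> nat,
    tends_to_infinity h /\ NP_hard (johnson_coverage_star alpha z y h).

(* At least two points are required: for n = 1 both thresholds rho n log n below vanish, so that
   completeness and soundness hold simultaneously. *)
Definition kmedian_wf (d k : nat) (P : seq (d.-tuple bool)) : Prop :=
  [/\ (0 < k)%N, (1 < size P)%N & uniq P].

Definition kmedian_encode (d k : nat) (P : seq (d.-tuple bool)) : seq bool :=
  unary d ++ unary k ++ flatten [seq tval a | a <- P].

Definition cube_point (R : realType) (d : nat) (a : d.-tuple bool) : 'rV[R]_d :=
  \row_i (tnth a i)%:R.

(* The library norm on ['rV[R]_d] is the sup norm. *)
Definition l1norm (R : realType) (d : nat) (v : 'rV[R]_d) : R :=
  \sum_i `|v ord0 i|.

(* The assignment of points to centers is given by the index of the center. *)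
Definition kmedian_cost (R : realType) (d k : nat) (P : seq (d.-tuple bool))
    (c : 'I_k -> 'rV[R]_d) (sigma : d.-tuple bool -> 'I_k) : R :=
  \sum_(a <- P) l1norm (cube_point R a - c (sigma a)).

(* [D] is the constant of d = O(log n); the base of the logarithm is absorbed
   by [rho] and [D]. *)
Definition kmedian_gap (R : realType) (rho gamma D : R) : promise_problem :=
  PromiseProblem
    (fun x => exists (d k : nat) (P : seq (d.-tuple bool)),
       let n : R := (size P)%:R in
       [/\ kmedian_wf k P, d%:R <= D * ln n, x = kmedian_encode k P
         & exists (c : 'I_k -> 'rV[R]_d) (sigma : d.-tuple bool -> 'I_k),
             kmedian_cost P c sigma <= rho * n * ln n])
    (fun x => exists (d k : nat) (P : seq (d.-tuple bool)),
       let n : R := (size P)%:R in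
       [/\ kmedian_wf k P, d%:R <= D * ln n, x = kmedian_encode k P
         & forall (c : 'I_k -> 'rV[R]_d) (sigma : d.-tuple bool -> 'I_k),
             gamma * (rho * n * ln n) <= kmedian_cost P c sigma]).

(* Main.v *)
(** In a Turing machine, the part of a tape from its head up to the first blank is a stack
    of bits; programs over finitely many stacks therefore compile to multitape machines, and can
    be run after a given machine on its output tape.  This reduces polynomial-time computability
    of the reduction to a structured program.

    The reduction maps a set [T] of the Johnson coverage instance to the union [a_T] of words
    [r_i], [i \in T], of equal weight [N] and small pairwise overlaps.  With [l] the integer part
    of [log2 |E|] the words have length [d = O(l)] and weight [N = s * l], overlap in at most [l]
    positions, and are found by a greedy search through all [2 ^ d] words, which is polynomial in
    [|E|].  Only elements that occur in [E] receive a word, since the universe may be much larger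
    than [E].

    Completeness: [a_T] is at distance at most [(z - y) N] from [a_S] for [S \subset T].
    Soundness: by the triangle inequality, sets whose points are closer than about
    [(z - y + 1) N] to the same center pairwise share at least [y] elements.  Such a family
    either has a common subset of size [y] or has [O(n ^ (z - y - 1))] members, and the
    hypothesis on [|E|] makes the latter negligible; the same holds for sets closer than about
    [(z - y) N], which pairwise share more than [y] elements.  Hence all but about
    [alpha |E|] points pay [(z - y + 1) N], and the remaining ones [(z - y) N]. *)

From HB Require Import structures.
Require Import Defs.
From mathcomp Require Import all_boot all_order all_algebra zify ring lra.
From mathcomp Require Import boolp reals exp.

Set Implicit Arguments.
Unset Strict Implicit.
Unset Printing Implicit Defensive.

Import Order.TTheory GRing.Theory Num.Theory.

(** The hypothesis on |E| is asymptotic: below some universe size [N0] it says nothing, yet such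
    instances must also be answered correctly and in polynomial time. A no-instance has fewer
    centers than sets, so only finitely many no-instances lie below [N0]. The program therefore
    begins with a decision tree on a constant number of input bits. Its leaves contain a fixed
    no-instance for these inputs and a fixed yes-instance for all other small ones. The error eps is
    split into three thirds. Overlaps of the words cost a fraction of order z/s, the gap between ln
    |E| and l ln 2 a fraction of order 1/l, and the exceptional sets a fraction of |E| that the
    hypothesis controls. A single integer K, of order 1/eps for fixed z, makes all three small. *)

(** * A language of stack programs and its compilation to jump code *)

Definition store := nat -> seq bool.
Definition upd (s : store) (i : nat) (v : seq bool) : store :=
  fun j => if j == i then v else s j.

(** Tests see the top of a stack as a tape symbol, [None] standing for the empty stack, so they
    apply unchanged to the cell scanned by a machine. *)
Inductive cmd :=
  | Skip
  | Push of nat & bool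
  | Pop of nat
  | Seq of cmd & cmd
  | If of (symbol -> bool) & nat & cmd & cmd
  | While of (symbol -> bool) & nat & cmd.

Inductive instr :=
  | IPush of nat & bool
  | IPop of nat
  | IBr of (symbol -> bool) & nat & nat & nat.

Definition istep (code : seq instr) (c : nat * store) : nat * store :=
  match onth code c.1 with
  | Some (IPush i b) => (c.1.+1, upd c.2 i (b :: c.2 i))
  | Some (IPop i) => (c.1.+1, upd c.2 i (behead (c.2 i)))
  | Some (IBr p i t e) => (if p (ohead (c.2 i)) then t else e, c.2)
  | None => c
  end.

Fixpoint len (c : cmd) : nat :=
  match c with
  | Skip => 0
  | Push _ _ | Pop _ => 1
  | Seq c1 c2 => len c1 + len c2
  | If _ _ c1 c2 => (len c1 + (len c2).+1).+1
  | While _ _ c1 => (len c1).+2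
  end.

(** Jump targets are absolute, whence the address [a]. An unconditional jump is a branch on [xpredT]
    with a dummy register, and execution stops by running off the end of the code. *)
Fixpoint compile (c : cmd) (a : nat) : seq instr :=
  match c with
  | Skip => [::]
  | Push i b => [:: IPush i b]
  | Pop i => [:: IPop i]
  | Seq c1 c2 => compile c1 a ++ compile c2 (a + len c1)
  | If p i c1 c2 =>
      let b := (a + len c1).+2 in
      IBr p i a.+1 b :: compile c1 a.+1 ++
      IBr xpredT 0 (b + len c2) (b + len c2) :: compile c2 b
  | While p i c1 =>
      rcons (IBr p i a.+1 (a + len c1).+2 :: compile c1 a.+1) (IBr xpredT 0 a a)
  end.

Lemma size_compile c a : size (compile c a) = len c.
Proof.
elim: c a => //= [c1 IH1 c2 IH2|p i c1 IH1 c2 IH2|p i c1 IH1] a.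
- by rewrite size_cat IH1 IH2.
- by rewrite size_cat /= IH1 IH2.
- by rewrite size_rcons IH1.
Qed.

(** Bounds on registers and targets make finitely many tapes and states sufficient. A target may
    equal [e], in use the length of the code, which is the halting address. *)
Definition wf_instr (r e : nat) (x : instr) : bool :=
  match x with
  | IPush i _ | IPop i => i <= r
  | IBr _ i t u => [&& i <= r, t <= e & u <= e]
  end.

Fixpoint max_reg (c : cmd) : nat :=
  match c with
  | Skip => 0
  | Push i _ | Pop i => i
  | Seq c1 c2 => maxn (max_reg c1) (max_reg c2)
  | If _ i c1 c2 => maxn i (maxn (max_reg c1) (max_reg c2))
  | While _ i c1 => maxn i (max_reg c1)
  end.

Lemma wf_compile c a r e : max_reg c <= r -> a + len c <= e ->
  all (wf_instr r e) (compile c a).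
Proof.
elim: c a r => //= [i b|i|c1 IH1 c2 IH2|p i c1 IH1 c2 IH2|p i c1 IH1] a r.
- by rewrite andbT.
- by rewrite andbT.
- by rewrite geq_max all_cat => /andP[h1 h2] h; rewrite IH1 ?IH2 //; lia.
- rewrite !geq_max all_cat /= => /and3P[-> h1 h2] h.
  by rewrite IH1 ?IH2 //; lia.
- rewrite !geq_max all_rcons /= => /andP[-> h1] h.
  by rewrite IH1 //; lia.
Qed.

Definition code_at (code : seq instr) (a : nat) (l : seq instr) : Prop :=
  exists pre post, code = pre ++ l ++ post /\ size pre = a.

Lemma code_at_catl code a l1 l2 : code_at code a (l1 ++ l2) -> code_at code a l1.
Proof. by move=> [pre [post [-> h]]]; exists pre, (l2 ++ post); rewrite -catA. Qed.

Lemma code_at_catr code a l1 l2 :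
  code_at code a (l1 ++ l2) -> code_at code (a + size l1) l2.
Proof.
move=> [pre [post [-> <-]]]; exists (pre ++ l1), post.
by rewrite -!catA size_cat.
Qed.

Lemma code_at_onth code a x l : code_at code a (x :: l) -> onth code a = Some x.
Proof.
by move=> [pre [post [-> <-]]]; rewrite onth_cat ltnn subnn.
Qed.

(* [run c s s' T]: started in [s], the command [c] stops in [s'] after at most [T] steps,
   wherever its compiled code is placed. *)
Definition run (c : cmd) (s s' : store) (T : nat) : Prop :=
  forall code a, code_at code a (compile c a) ->
  exists2 t, t <= T & iter t (istep code) (a, s) = (a + len c, s').

Lemma run_conv c s s1 s2 T1 T2 :
  run c s s1 T1 -> s1 = s2 -> T1 <= T2 -> run c s s2 T2.
Proof.
move=> h <- hT code a /h[t ht e]; exists t => //; exact: leq_trans hT.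
Qed.

Lemma run_skip s : run Skip s s 0.
Proof. by move=> code a _; exists 0 => //=; rewrite addn0. Qed.

Lemma run_push s i b : run (Push i b) s (upd s i (b :: s i)) 1.
Proof.
move=> code a /code_at_onth e; exists 1 => //=.
by rewrite /istep /= e addn1.
Qed.

Lemma run_pop s i : run (Pop i) s (upd s i (behead (s i))) 1.
Proof.
move=> code a /code_at_onth e; exists 1 => //=.
by rewrite /istep /= e addn1.
Qed.

Lemma run_seq c1 c2 s s1 s2 T1 T2 :
  run c1 s s1 T1 -> run c2 s1 s2 T2 -> run (Seq c1 c2) s s2 (T1 + T2).
Proof.
move=> h1 h2 code a /= h.
have [t1 le1 e1] := h1 _ _ (code_at_catl h).
have := code_at_catr h; rewrite size_compile => /h2[t2 le2 e2].
exists (t2 + t1); first by rewrite addnC leq_add.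
by rewrite iterD e1 e2 addnA.
Qed.

Lemma istep_br code a p i t e l s : code_at code a (IBr p i t e :: l) ->
  istep code (a, s) = (if p (ohead (s i)) then t else e, s).
Proof. by move=> /code_at_onth h; rewrite /istep /= h. Qed.

Lemma run_if p i c1 c2 s s1 T :
  run (if p (ohead (s i)) then c1 else c2) s s1 T -> run (If p i c1 c2) s s1 T.+2.
Proof.
move=> h code a /=; set b := (a + len c1).+2 => hc.
have hc1 := code_at_catr (l1 := [:: _]) hc.
have hc2 := code_at_catr hc1; rewrite /= size_compile addn1 in hc2.
have {hc1} := code_at_catl hc1; rewrite /= addn1 => hc1.
have hc3 := code_at_catr (l1 := [:: _]) hc2; rewrite /= addn1 in hc3.
rewrite -[(a.+1 + len c1).+1]/b in hc3.
have e0 := istep_br s hc.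
case: (p _) h e0 => h e0.
  have [t ht e] := h _ _ hc1.
  exists t.+2; first by [].
  rewrite iterS -[t.+1]addn1 iterD /= e0 e (istep_br _ hc2) /=.
  by congr pair; rewrite /b; lia.
have [t ht e] := h _ _ hc3.
exists t.+1; first by rewrite ltnS ltnW.
rewrite -[t.+1]addn1 iterD /= e0 e.
by congr pair; rewrite /b; lia.
Qed.

Lemma run_while_stop p i c s : ~~ p (ohead (s i)) -> run (While p i c) s s 1.
Proof.
move=> h code a /= hc; exists 1 => //=.
by rewrite (istep_br s hc) (negPf h) !addnS.
Qed.

Lemma run_while_step (p : symbol -> bool) i c s s1 s2 T1 T2 :
  p (ohead (s i)) -> run c s s1 T1 -> run (While p i c) s1 s2 T2 ->
  run (While p i c) s s2 (T1 + T2).+2.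
Proof.
move=> h h1 h2 code a hc.
have [t2 le2 e2] := h2 _ _ hc.
move: hc => /=; rewrite -cats1 => hc; have e0 := istep_br s hc.
have hc1 := code_at_catr (l1 := [:: _]) hc.
have hc2 := code_at_catr hc1; rewrite /= size_compile addn1 in hc2.
have := code_at_catl hc1; rewrite /= addn1 => /h1[t1 le1 e1].
exists (t2 + (1 + (t1 + 1))); first by lia.
rewrite iterD iterD [iter (t1 + 1) _ _]iterD /= e0 h e1 (istep_br _ hc2) /= e2.
by [].
Qed.

(** * From stack programs to Turing machines *)

Section Composite.

Variables (M : TM) (code : seq instr) (K : nat).
Hypothesis wf_code : all (wf_instr K.+1 (size code)) code.

Local Notation m := (TM_tapes M).

(* Stack 0 is the input/output tape of [M]; the other stacks are fresh tapes. *)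
Definition tape_of (i : nat) : 'I_(m.+1 + K.+1) :=
  if i is j.+1 then rshift m.+1 (inord j) else lshift K.+1 ord0.

Lemma tape_of_inj i j : i <= K.+1 -> j <= K.+1 -> (tape_of i == tape_of j) = (i == j).
Proof.
case: i j => [|i] [|j] // hi hj; rewrite -val_eqE /= ?inordK //.
by rewrite eqn_add2l.
Qed.

(** The Boolean is the phase of a push: a machine writes before it moves, so one step goes left and
    a second one writes the new top. *)
Definition composite_state : finType :=
  (TM_state M + 'I_(size code).+1 * bool)%type.

Definition at_pc (pc : nat) : composite_state := inr (inord pc, false).

Local Notation reading := {ffun 'I_(m.+1 + K.+1) -> symbol}.
Local Notation actions := ('I_(m.+1 + K.+1) -> symbol * move).

Definition idle (r : reading) : actions := fun j => (r j, Stay).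
Definition act_on (r : reading) (i : nat) (a : symbol * move) : actions :=
  fun j => if j == tape_of i then a else (r j, Stay).

(** Popping an empty stack must not move the head, since bits left beyond the blank would then
    become part of the stack. *)
Definition composite_delta (q : composite_state) (r : reading) :
    composite_state * actions :=
  match q with
  | inl q =>
      if TM_halt q then (at_pc 0, idle r) else
      let qa := TM_delta q [ffun i => r (lshift K.+1 i)] in
      (inl qa.1, fun j => if split j is inl i then qa.2 i else (r j, Stay))
  | inr (pc, ph) =>
      match onth code pc with
      | None => (q, idle r)
      | Some (IPush i b) =>
          if ph then (at_pc pc.+1, act_on r i (Some b, Stay))
          else (inr (pc, true), act_on r i (r (tape_of i), MoveL))
      | Some (IPop i) =>
          (at_pc pc.+1,
           act_on r i (r (tape_of i), if r (tape_of i) is None then Stay else MoveR))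
      | Some (IBr p i t e) => (at_pc (if p (r (tape_of i)) then t else e), idle r)
      end
  end.

Definition composite_halt (q : composite_state) : bool :=
  if q is inr (pc, _) then pc == size code :> nat else false.

Definition composite : TM :=
  @Build_TM (m + K.+1) composite_state (inl (TM_start M)) composite_halt
    composite_delta.

Definition stack_of (t : tape) : seq bool := bits_until_blank (tright t).

Lemma head_stack_of t : ohead (stack_of t) = tape_read t.
Proof. by case: t => l [|[b|] r]. Qed.

Lemma stack_of_idle t : stack_of (tape_act t (tape_read t, Stay)) = stack_of t.
Proof. by case: t => l [|[b|] r]. Qed.

Definition sim (c : nat * store) (cfg : TM_config composite) : Prop :=
  [/\ cfg.1 = at_pc c.1, c.1 <= size code
    & forall i, i <= K.+1 -> stack_of (cfg.2 (tape_of i)) = c.2 i].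

Lemma sim_step c cfg : sim c cfg ->
  exists2 t, t <= 2 & sim (istep code c) (iter t (@TM_step composite) cfg).
Proof.
case: c cfg => pc s [q tp] [/= -> hpc hs].
have [lt_pc|ge_pc] := ltnP pc (size code); last first.
  exists 0 => //=; rewrite /istep /= onth_default //.
pose x := nth (IPop 0) code pc.
have ox : onth code pc = Some x by rewrite onthE (nth_map (IPop 0)).
have wx : wf_instr K.+1 (size code) x by move: wf_code => /(all_nthP (IPop 0)); apply.
have npc := ltn_eqF lt_pc.
have idleP (tp' : {ffun 'I_(m.+1 + K.+1) -> tape}) i :
    stack_of (tape_act (tp' (tape_of i)) (idle [ffun i => tape_read (tp' i)] (tape_of i)))
    = stack_of (tp' (tape_of i)).
  by rewrite /idle ffunE stack_of_idle.
rewrite /istep /= ox; case: x wx ox => [i b|i|p i u e] /= wx ox.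
- exists 2 => //; rewrite /= /TM_step /= !inordK ?ltnS // npc ox /=.
  rewrite !inordK ?ltnS // npc ox /=; split => //= j hj.
  rewrite !ffunE /act_on tape_of_inj // !ffunE /upd.
  case: eqP => [->|nj].
    by rewrite -(hs i) //; case: (tp _) => [l [|y r]].
  by rewrite tape_of_inj // (introF eqP nj) !stack_of_idle hs.
- exists 1 => //; rewrite /= /TM_step /= !inordK ?ltnS // npc ox /=.
  split => //= j hj.
  rewrite !ffunE /act_on tape_of_inj // /upd.
  case: eqP => [->|nj]; last by rewrite ffunE stack_of_idle hs.
  rewrite -(hs i) //.
  by case: (tp _) => [l [|[y|] r]].
- exists 1 => //; rewrite /= /TM_step /= !inordK ?ltnS // npc ox /=.
  rewrite !ffunE -head_stack_of hs; last by case/andP: wx.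
  split => //=; first by case: (p _) => //; case/and3P: wx.
  by move=> j hj; rewrite !ffunE idleP hs.
Qed.

Lemma sim_iter T c cfg : sim c cfg ->
  exists2 t, t <= 2 * T & sim (iter T (istep code) c) (iter t (@TM_step composite) cfg).
Proof.
elim: T c cfg => [|T IH] c cfg h; first by exists 0.
have [t1 le1 h1] := sim_step h.
have [t2 le2 h2] := IH _ _ h1.
exists (t2 + t1); first by lia.
by rewrite iterSr iterD.
Qed.

(* While [M] runs, idle steps pad the fresh tapes with blanks. *)
Definition sim_prefix (c : TM_config M) (cfg : TM_config composite) : Prop :=
  [/\ cfg.1 = inl c.1, forall i : 'I_m.+1, cfg.2 (lshift K.+1 i : 'I_(m.+1 + K.+1)) = c.2 i
    & forall i : 'I_K.+1, stack_of (cfg.2 (rshift m.+1 i : 'I_(m.+1 + K.+1))) = [::]].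

Lemma sim_prefix_init x : sim_prefix (TM_init M x) (TM_init composite x).
Proof.
split=> //= [i|i]; rewrite !ffunE.
  by rewrite -val_eqE /= -[i == ord0]val_eqE.
by [].
Qed.

Lemma sim_prefix_step c cfg : ~~ TM_halt c.1 -> sim_prefix c cfg ->
  sim_prefix (TM_step c) (TM_step (M := composite) cfg).
Proof.
case: c cfg => q tp [Q tp'] /= hq [/= -> h1 h2].
rewrite /TM_step /= (negPf hq) /=.
have -> : [ffun i : 'I_m.+1 => [ffun j => tape_read (tp' j)] (lshift K.+1 i : 'I_(m.+1 + K.+1))] =
          [ffun i => tape_read (tp i)] :> {ffun 'I_m.+1 -> symbol}.
  by apply/ffunP => i; rewrite !ffunE h1.
split => //= i; rewrite !ffunE.
  by rewrite (unsplitK (inl i)) h1.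
by rewrite (unsplitK (inr i)) stack_of_idle h2.
Qed.

Lemma sim_prefix_iter t x :
  (forall j, j < t -> ~~ TM_halt (iter j (@TM_step M) (TM_init M x)).1) ->
  sim_prefix (iter t (@TM_step M) (TM_init M x))
             (iter t (@TM_step composite) (TM_init composite x)).
Proof.
elim: t => [|t IH] h; first exact: sim_prefix_init.
rewrite !iterS; apply: sim_prefix_step; first exact: h.
by apply: IH => j hj; apply: h; rewrite ltnS ltnW.
Qed.

Lemma TM_step_halted (N : TM) (c : TM_config N) t :
  TM_halt c.1 -> iter t (@TM_step N) c = c.
Proof. by move=> h; elim: t => //= t ->; rewrite /TM_step h. Qed.

Lemma composite_correct x T (s : store) T2 :
  let cf := iter T (@TM_step M) (TM_init M x) in
  TM_halt cf.1 ->
  (exists2 t, t <= T2 & iter t (istep code)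
     (0, fun i => if i is 0 then TM_output cf else [::]) = (size code, s)) ->
  let cf' := iter (T + 2 * T2 + 1) (@TM_step composite) (TM_init composite x) in
  TM_halt cf'.1 /\ TM_output cf' = s 0.
Proof.
move=> cf hcf [t le_t et].
(* The composite leaves the simulation of [M] at the first halting time, possibly before [T]; one
   further step hands over to the program. *)
have ex : exists t, TM_halt (iter t (@TM_step M) (TM_init M x)).1 by exists T.
have hT0 := ex_minnP ex; case: hT0 => t0 h0 min0.
have le0 : t0 <= T by apply: min0.
have ecf : cf = iter t0 (@TM_step M) (TM_init M x).
  by rewrite /cf -(subnK le0) iterD TM_step_halted.
have [e1 e2 e3] : sim_prefix cf (iter t0 (@TM_step composite) (TM_init composite x)).
  rewrite ecf; apply: sim_prefix_iter => j hj.
  by apply: contraL hj => /min0; rewrite -leqNgt.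
have hsim : sim (0, fun i => if i is 0 then TM_output cf else [::])
    (iter t0.+1 (@TM_step composite) (TM_init composite x)).
  rewrite iterS; move: (iter _ _ _) e1 e2 e3 => [Q tp] /= -> e2 e3.
  rewrite /TM_step /= hcf; split => //= -[|i] hi; rewrite ffunE /idle ffunE stack_of_idle.
    by rewrite /tape_of e2.
  by rewrite e3.
have [u leu [eq1 _ eq3]] := sim_iter t hsim.
rewrite et in eq1 eq3.
have hle : u + t0.+1 <= T + 2 * T2 + 1 by lia.
have hh : TM_halt (iter (u + t0.+1) (@TM_step composite) (TM_init composite x)).1.
  by rewrite iterD eq1 /= inordK.
have -> : iter (T + 2 * T2 + 1) (@TM_step composite) (TM_init composite x) =
          iter (u + t0.+1) (@TM_step composite) (TM_init composite x).
  by rewrite -(subnK hle) iterD TM_step_halted.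
split=> //.
have /= <- := eq3 0 isT.
rewrite /TM_output iterD /stack_of.
by congr (bits_until_blank (tright (_ _))); apply: val_inj.
Qed.

End Composite.

(** * Polynomial bounds, and running a stack program after a machine *)

(** The base is at least 2 for every [m], so its powers absorb constants and sums without a special
    case for small [m]. *)
Definition poly_le (F : nat -> nat) : Prop := exists a, forall m, F m <= m.+2 ^ a.

Lemma poly_le_mono F G : (forall m, F m <= G m) -> poly_le G -> poly_le F.
Proof. by move=> h [a ha]; exists a => m; apply: leq_trans (ha m). Qed.

Lemma poly_le_const c : poly_le (fun=> c).
Proof. by exists c => m; apply/ltnW/ltn_expl. Qed.

Lemma poly_le_id : poly_le id.
Proof. by exists 1 => m; rewrite expn1; lia. Qed.

Lemma poly_le_mul F G : poly_le F -> poly_le G -> poly_le (fun m => F m * G m).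
Proof. by move=> [a ha] [b hb]; exists (a + b) => m; rewrite expnD leq_mul. Qed.

Lemma poly_le_add F G : poly_le F -> poly_le G -> poly_le (fun m => F m + G m).
Proof.
move=> [a ha] [b hb]; exists (a + b).+1 => m; rewrite expnS expnD.
have := ha m; have := hb m.
have : 0 < m.+2 ^ a by rewrite expn_gt0.
have : 0 < m.+2 ^ b by rewrite expn_gt0.
nia.
Qed.

Lemma poly_le_exp F a : poly_le F -> poly_le (fun m => F m ^ a).
Proof.
move=> h; elim: a => [|a IH]; first exact: (poly_le_const 1).
by apply: (poly_le_mono (G := fun m => F m * F m ^ a)) (poly_le_mul h IH) => m;
  rewrite expnS.
Qed.

Lemma poly_le_bound c : poly_le (poly_bound c).
Proof.
apply: poly_le_add (poly_le_const c); apply: poly_le_mul (poly_le_const c) _.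
exact/poly_le_exp/poly_le_id.
Qed.

Lemma poly_le_poly_bound F : poly_le F -> exists c, forall m, F m <= poly_bound c m.
Proof.
(* For positive [m], [m + 2 <= 3 * m], so [3 ^ a] serves as coefficient; it also bounds the exponent
   [a] and, at [m = 0], the value [2 ^ a]. *)
move=> [a ha]; exists (3 ^ a) => m; apply: leq_trans (ha m) _; rewrite /poly_bound.
have leE i j k : i <= j -> i ^ k <= j ^ k by case: k => // k h; rewrite leq_exp2r.
have h3 : a <= 3 ^ a by apply/ltnW/ltn_expl.
case: m => [|m].
  by apply: leq_trans (leq_addl _ _); apply: leE.
apply: leq_trans (leq_addr _ _); apply: (@leq_trans ((3 * m.+1) ^ a)).
  by apply: leE; lia.
rewrite expnMn leq_mul2l; apply/orP; right; exact: leq_pexp2l.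
Qed.

Lemma size_bits_until_blank s : size (bits_until_blank s) <= size s.
Proof. by elim: s => [|[b|] s IH]. Qed.

Lemma size_tright_act t a : size (tright (tape_act t a)) <= (size (tright t)).+2.
Proof.
by case: t a => l r [b []] /=; rewrite size_behead; lia.
Qed.

(** A step lists at most two more cells on the right, as when the head moves left from an empty
    list. This bounds the input of a program run on the output. *)
Lemma size_TM_output (M : TM) x t :
  size (TM_output (iter t (@TM_step M) (TM_init M x))) <= size x + 2 * t.
Proof.
apply: leq_trans (size_bits_until_blank _) _.
elim: t => [|t IH] /=; first by rewrite ffunE /= size_map addn0.
rewrite {1}/TM_step; case: ifP => _; first by apply: leq_trans IH _; lia.
by rewrite /= ffunE; apply: leq_trans (size_tright_act _ _) _; lia.
Qed.

Definition input_store (x : seq bool) : store := fun i => if i is 0 then x else [::].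

Lemma poly_time_post f g c F : poly_time f -> poly_le F ->
  (forall x, exists2 s, run c (input_store (f x)) s (F (size (f x))) & s 0 = g x) ->
  poly_time g.
Proof.
move=> [M [c1 hM]] [a ha] hc.
pose code := compile c 0; pose K := max_reg c.
have hwf : all (wf_instr K.+1 (size code)) code.
  by apply: wf_compile; rewrite ?size_compile // ltnW.
(* [F] need not be monotone, but its bound [m.+2 ^ a] is, so that bound is evaluated at the largest
   possible length of [f x]. *)
have [e he] : exists e, forall m, poly_bound c1 m +
    2 * (m + 2 * poly_bound c1 m + 2) ^ a + 1 <= poly_bound e m.
  apply: poly_le_poly_bound.
  apply: poly_le_add (poly_le_const _); apply: poly_le_add (poly_le_bound _) _.
  apply: poly_le_mul (poly_le_const _) _; apply: poly_le_exp.
  apply: poly_le_add (poly_le_const _).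
  apply: poly_le_add poly_le_id _.
  exact: poly_le_mul (poly_le_const _) (poly_le_bound _).
exists (composite M code K), e => x.
have [h1 h2] := hM x.
have [s hs hg] := hc x.
have [t ht et] : exists2 t, t <= (size x + 2 * poly_bound c1 (size x) + 2) ^ a &
    iter t (istep code) (0, input_store (f x)) = (size code, s).
  have [|t ht et] := hs code 0; first by exists [::], [::]; rewrite cats0.
  exists t; last by rewrite et size_compile.
  apply: leq_trans ht _; apply: leq_trans (ha _) _.
  have hsz : size (f x) <= size x + 2 * poly_bound c1 (size x).
    by rewrite -h2 size_TM_output.
  by case: (a) => // b; rewrite leq_exp2r //; lia.
rewrite -h2 in et.
have /= [] := composite_correct hwf h1 (ex_intro2 _ _ t ht et).
set N := _ + _ + _ => h3 h4.
have hle : N <= poly_bound e (size x) by apply: he.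
by rewrite -(subnK hle) iterD TM_step_halted // h4.
Qed.

(** * A library of stack programs *)

Definition is_one : symbol -> bool := fun x => x == Some true.
Definition nonempty : symbol -> bool := fun x => x != None.

Ltac split_neq :=
  repeat match goal with
  | H : is_true (uniq _) |- _ => rewrite /= !inE !negb_or in H
  | H : is_true (_ && _) |- _ => case/andP: H => ? ?
  end.

(* Evaluates [upd]; comparisons of registers not decided by a hypothesis are split. *)
Ltac solve_store :=
  try (apply: funext => ?); rewrite /upd;
  repeat match goal with
  | |- context [?a == ?a :> nat] => rewrite (eqxx a)
  | H : is_true (?a != ?b) |- context [?a == ?b] => rewrite (negPf H)
  | H : is_true (?a != ?b) |- context [?b == ?a] => rewrite (eq_sym b a) (negPf H)
  | |- context [?a == ?b :> nat] =>
      let h := fresh in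
      case h: (a == b); [have {}h : a = b := elimT eqP h; rewrite ?h | ]
  end; try done; try congruence.

Definition shift1 (i j : nat) : cmd :=
  If is_one i (Seq (Pop i) (Push j true)) (Seq (Pop i) (Push j false)).

Lemma run_shift1 (i j : nat) (s : store) b l : i != j -> s i = b :: l ->
  run (shift1 i j) s (upd (upd s i l) j (b :: s j)) 4.
Proof.
move=> hij e; apply: run_if; rewrite e.
by case: b e => e; (apply: run_conv; first by apply: run_seq;
  [apply: run_pop | apply: run_push]); rewrite // e /=; solve_store.
Qed.

Definition mv (i j : nat) : cmd := While nonempty i (shift1 i j).

Lemma run_mv (i j : nat) (s : store) : i != j ->
  run (mv i j) s (upd (upd s i [::]) j (catrev (s i) (s j))) (6 * size (s i) + 1).
Proof.
move=> hij; move e: (s i) => li; elim: li s e => [|b l IH] s e.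
  by apply: run_conv; [apply: run_while_stop; rewrite e | solve_store |].
apply: run_conv.
- apply: run_while_step; first by rewrite e.
    exact: run_shift1 e.
  by apply: IH; solve_store.
- by rewrite /=; solve_store.
- by rewrite /=; clear; lia.
Qed.

(** A stack is read by consuming it, so what must survive moves to a primed partner, in reverse.
    With [t = false] the word on [R] is passed over without being merged. *)
Definition merge (t : bool) (A A' R R' : nat) : cmd :=
  While nonempty A
    (Seq (if t then If is_one R (Seq (Pop A) (Push A' true)) (shift1 A A') else shift1 A A')
         (shift1 R R')).

Fixpoint orv (t : bool) (a r : seq bool) : seq bool :=
  if a is x :: a' then (x || (t && head false r)) :: orv t a' (behead r) else [::].

Lemma size_orv t a r : size (orv t a r) = size a.
Proof. by elim: a r => //= x a IH r; rewrite IH. Qed.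

Lemma nth_orv t a r i : i < size a ->
  nth false (orv t a r) i = nth false a i || (t && nth false r i).
Proof.
elim: a r i => //= x a IH r [|i] hi /=; first by case: r.
by rewrite IH // nth_behead.
Qed.

Lemma run_merge t (A A' R R' : nat) (s : store) : uniq [:: A; A'; R; R'] -> size (s A) <= size (s R) ->
  run (merge t A A' R R') s
    (upd (upd (upd (upd s A [::]) A' (catrev (orv t (s A) (s R)) (s A')))
       R (drop (size (s A)) (s R))) R' (catrev (take (size (s A)) (s R)) (s R')))
    (12 * size (s A) + 1).
Proof.
move=> hu; split_neq; move eA: (s A) => l; elim: l s eA => [|a la IH] s eA.
  move=> _; apply: run_conv; first by apply: run_while_stop; rewrite eA.
    by rewrite drop0 take0; solve_store.
  by [].
case eR: (s R) => [|r lr] /= hsz; first by rewrite ltn0 in hsz.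
pose s1 := upd (upd s A la) A' ((a || (t && r)) :: s A').
pose s2 := upd (upd s1 R lr) R' (r :: s R').
have h1 : run (if t then If is_one R (Seq (Pop A) (Push A' true)) (shift1 A A')
               else shift1 A A') s s1 6.
  rewrite /s1; case: t IH {s1 s2} => IH; last first.
    apply: run_conv; first by apply: (run_shift1 (b := a) (l := la)) => //.
      by rewrite orbF.
    by [].
  apply: run_if; rewrite eR; case: r eR hsz => eR hsz /=.
    apply: run_conv; first by apply: run_seq; [apply: run_pop | apply: run_push].
      by rewrite orbT eA; solve_store.
    by [].
  apply: run_conv; first by apply: (run_shift1 (b := a) (l := la)) => //.
    by rewrite orbF.
  by [].
have h2 : run (shift1 R R') s1 s2 4.
  apply: run_conv; first by apply: (run_shift1 (b := r) (l := lr)); rewrite /s1; solve_store.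
    by rewrite /s2 /s1; solve_store.
  by [].
have eA2 : s2 A = la by rewrite /s2 /s1; solve_store.
have eR2 : s2 R = lr by rewrite /s2 /s1; solve_store.
have eA2' : s2 A' = (a || (t && r)) :: s A' by rewrite /s2 /s1; solve_store.
have eR2' : s2 R' = r :: s R' by rewrite /s2 /s1; solve_store.
apply: run_conv.
- apply: run_while_step; first by rewrite eA.
    exact: run_seq h1 h2.
  by apply: IH => //; rewrite eR2.
- by rewrite eR2 eA2' eR2' /=; rewrite /s2 /s1; solve_store.
- by rewrite /=; clear; lia.
Qed.

Definition mergeb (t : bool) (A A' R R' : nat) : cmd :=
  Seq (merge t A A' R R') (mv A' A).

Lemma catrev2 (T : Type) (l : seq T) : catrev (catrev l [::]) [::] = l.
Proof. by rewrite !catrevE !cats0 revK. Qed.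

Lemma run_mergeb t (A A' R R' : nat) (s : store) : uniq [:: A; A'; R; R'] -> size (s A) <= size (s R) ->
  s A' = [::] ->
  run (mergeb t A A' R R') s
    (upd (upd (upd s A (orv t (s A) (s R)))
       R (drop (size (s A)) (s R))) R' (catrev (take (size (s A)) (s R)) (s R')))
    (18 * size (s A) + 2).
Proof.
move=> hu hsz eA'.
have h := @run_merge t _ _ _ _ _ hu hsz; split_neq.
set s1 := upd _ R' _ in h.
have e1 : s1 A' = catrev (orv t (s A) (s R)) [::] by rewrite /s1 eA'; solve_store.
have e2 : s1 A = [::] by rewrite /s1; solve_store.
apply: run_conv; first by apply: run_seq h _; apply: (@run_mv A' A); rewrite eq_sym.
- rewrite e1 e2 catrev2 /s1; solve_store.
- by rewrite e1 catrevE size_cat size_rev size_orv /=; lia.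
Qed.

(** [L] is a budget in unary: each common one moves a unit to [L'], or raises a flag on [F] once the
    budget is spent. Afterwards [L] tells whether the overlap fell short and [F] whether it was
    exceeded. *)
Definition intersect (w w' R R' L L' F : nat) : cmd :=
  While nonempty w
    (Seq (If is_one w (If is_one R (If is_one L (shift1 L L') (Push F true)) Skip) Skip)
       (Seq (shift1 w w') (shift1 R R'))).

Fixpoint inter (a r : seq bool) : nat :=
  if a is x :: a' then (x && head false r) + inter a' (behead r) else 0.

Lemma run_intersect (w w' R R' L L' F : nat) (s : store) p :
  uniq [:: w; w'; R; R'; L; L'; F] -> size (s w) <= size (s R) ->
  s L = nseq p true ->
  let c := inter (s w) (s R) in
  run (intersect w w' R R' L L' F) s
    (upd (upd (upd (upd (upd (upd (upd s w [::]) w' (catrev (s w) (s w')))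
       R (drop (size (s w)) (s R))) R' (catrev (take (size (s w)) (s R)) (s R')))
       L (nseq (p - c) true)) L' (catrev (nseq (minn c p) true) (s L')))
       F (nseq (c - p) true ++ s F))
    (20 * size (s w) + 1).
Proof.
move=> hu; split_neq; move eA: (s w) => l; elim: l s p eA => [|a la IH] s p eA hsz eL.
  apply: run_conv; first by apply: run_while_stop; rewrite eA.
    by rewrite drop0 take0 /= subn0 min0n -eL; solve_store.
  by [].
case eR: (s R) hsz => [|r lr] /= hsz; first by rewrite ltn0 in hsz.
have [x hx] : exists x : nat, x = (a && r) :> nat by eexists.
pose s1 := upd (upd (upd s L (nseq (p - x) true)) L' (catrev (nseq (minn x p) true) (s L')))
  F (nseq (x - p) true ++ s F).
pose s2 := upd (upd s1 w la) w' (a :: s w').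
pose s3 := upd (upd s2 R lr) R' (r :: s R').
have h1 : run (If is_one w (If is_one R (If is_one L (shift1 L L') (Push F true)) Skip) Skip) s s1 10.
  have s1E := erefl s1; rewrite {2}/s1 in s1E.
  have h0 : x = 0 -> s = s1.
    by move=> ex; rewrite s1E ex subn0 min0n sub0n /=; rewrite -eL; solve_store.
  clear s2 s3 IH; clearbody s1; move: hx; rewrite -[10]/(6.+2.+2).
  case: a eA => eA hx; apply: run_if; rewrite eA /=; last first.
    by apply: run_conv; [exact: run_skip | exact: h0 |].
  apply: run_if; rewrite eR.
  case: r eR hx => eR hx /=; last first.
    by apply: run_conv; [exact: run_skip | exact: h0 |].
  rewrite -[6]/(4.+2); apply: run_if; rewrite eL.
  case: p eL s1E => [|p] eL s1E /=.
    by apply: run_conv; [exact: run_push | rewrite s1E hx /=; solve_store |].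
  apply: run_conv; first by apply: (run_shift1 (b := true) (l := nseq p true)) => //.
    by rewrite s1E hx (minn_idPl (ltn0Sn p)) subn1 subSS sub0n /=; solve_store.
  by [].
have h2 : run (shift1 w w') s1 s2 4.
  apply: run_conv; first by apply: (run_shift1 (b := a) (l := la)); rewrite /s1; solve_store.
    by rewrite /s2 /s1; solve_store.
  by [].
have h3 : run (shift1 R R') s2 s3 4.
  apply: run_conv; first by apply: (run_shift1 (b := r) (l := lr)); rewrite /s2 /s1; solve_store.
    by rewrite /s3 /s2 /s1; solve_store.
  by [].
have e1 : s3 w = la by rewrite /s3 /s2 /s1; solve_store.
have e2 : s3 w' = a :: s w' by rewrite /s3 /s2 /s1; solve_store.
have e3 : s3 R = lr by rewrite /s3 /s2 /s1; solve_store.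
have e4 : s3 R' = r :: s R' by rewrite /s3 /s2 /s1; solve_store.
have e5 : s3 L = nseq (p - x) true by rewrite /s3 /s2 /s1; solve_store.
have e6 : s3 L' = catrev (nseq (minn x p) true) (s L') by rewrite /s3 /s2 /s1; solve_store.
have e7 : s3 F = nseq (x - p) true ++ s F by rewrite /s3 /s2 /s1; solve_store.
apply: run_conv.
- apply: run_while_step; first by rewrite eA.
    apply: run_seq h1 _; exact: run_seq h2 h3.
  by apply: (IH _ (p - x)) => //; rewrite e3.
- rewrite e2 e3 e4 e6 e7 /= catA cat_nseq.
  set y := inter la lr.
  rewrite (_ : p - x - y = p - (x + y)); last by clear; lia.
  rewrite (_ : ncons _ _ _ = nseq (x + y - p) true); last first.
    by rewrite -cat_nseq -nseqD; congr nseq; clear; lia.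
  rewrite (_ : catrev _ (catrev _ _) = catrev (nseq (minn (x + y) p) true) (s L')); last first.
    rewrite !catrevE !rev_nseq catA -nseqD; congr (nseq _ _ ++ _); clear; lia.
  by rewrite /s3 /s2 /s1; solve_store.
- by rewrite /=; clear; lia.
Qed.

(** Stores of concrete programs are lists of stacks read by [nth], so that updates are evaluated by
    simplification. *)
Lemma upd_nth (l : seq (seq bool)) (i : nat) v :
  upd (nth [::] l) i v = nth [::] (set_nth [::] l i v).
Proof. by apply: funext => j; rewrite nth_set_nth. Qed.

Lemma cat_nseqS (T : Type) (b : T) n l : nseq n b ++ b :: l = b :: nseq n b ++ l.
Proof. by elim: n => //= n ->. Qed.

Lemma run_while_shift (i j : nat) (b : bool) n (s : store) r : i != j ->
  s i = nseq n true ++ r -> ~~ is_one (ohead r) ->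
  run (While is_one i (Seq (Pop i) (Push j b))) s
    (upd (upd s i r) j (nseq n b ++ s j)) (4 * n + 1).
Proof.
move=> hij; elim: n s => [|n IH] s /= e hr.
  by apply: run_conv; [apply: run_while_stop; rewrite e | solve_store |].
apply: run_conv.
- apply: run_while_step; first by rewrite e.
    by apply: run_seq; [apply: run_pop | apply: run_push].
  by apply: IH => //; rewrite e; solve_store.
- by rewrite -cat_nseqS; solve_store.
- by clear; lia.
Qed.

Lemma run_unary (i j : nat) (b : bool) n (s : store) r : i != j ->
  s i = unary n ++ r ->
  run (Seq (While is_one i (Seq (Pop i) (Push j b))) (Pop i)) s
    (upd (upd s i r) j (nseq n b ++ s j)) (4 * n + 2).
Proof.
rewrite /unary cat_rcons => hij e; apply: run_conv.
- by apply: run_seq; [exact: run_while_shift e _ | exact: run_pop].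
- by solve_store.
- by rewrite -addnA.
Qed.

Definition clear_stack (i : nat) : cmd := While nonempty i (Pop i).

Lemma run_clear_stack (i : nat) (s : store) :
  run (clear_stack i) s (upd s i [::]) (3 * size (s i) + 1).
Proof.
move e: (s i) => l; elim: l s e => [|b l IH] s e.
  by apply: run_conv; [apply: run_while_stop; rewrite e | solve_store |].
apply: run_conv.
- apply: run_while_step; [by rewrite e | exact: run_pop |].
  by apply: IH; rewrite e; solve_store.
- by solve_store.
- by rewrite /=; lia.
Qed.

Definition pushes (i : nat) (l : seq bool) : cmd :=
  foldr (fun b c => Seq c (Push i b)) Skip l.

Lemma run_pushes (i : nat) l (s : store) :
  run (pushes i l) s (upd s i (l ++ s i)) (size l).
Proof.
elim: l => [|b l IH] /=; first by apply: run_conv; [apply: run_skip | solve_store |].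
apply: run_conv; first by apply: run_seq; [exact: IH | exact: run_push].
  by solve_store.
by rewrite addn1.
Qed.

(* Binary counters, least significant bit first. *)
Fixpoint incr (w : seq bool) : seq bool :=
  match w with
  | [::] => [:: true]
  | true :: w' => false :: incr w'
  | false :: w' => true :: w'
  end.

Lemma lead_trues w : exists j r, [/\ w = nseq j true ++ r, ~~ is_one (ohead r) & j + size r = size w].
Proof.
elim: w => [|[] w [j [r [-> h e]]]]; first by exists 0, [::].
  by exists j.+1, r; split=> //=; rewrite -e addSn.
by exists 0, (false :: nseq j true ++ r).
Qed.

Lemma incr_trues j r : incr (nseq j true ++ r) = nseq j false ++ incr r.
Proof. by elim: j => //= j ->. Qed.

(* [c] is executed when all the bits of the counter are set. *)
Definition inc (w w' : nat) (c : cmd) : cmd :=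
  Seq (While is_one w (Seq (Pop w) (Push w' false)))
    (Seq (If nonempty w (Seq (Pop w) (Push w true)) c) (mv w' w)).

Lemma catrev_nseq (j : nat) (b : bool) r : catrev (nseq j b) r = nseq j b ++ r.
Proof. by rewrite catrevE rev_nseq. Qed.

Lemma run_inc (w w' : nat) c (s : store) : w != w' -> s w' = [::] -> false \in s w ->
  run (inc w w' c) s (upd s w (incr (s w))) (10 * size (s w) + 10).
Proof.
move=> hw e'; have [j [r [e hr sz]]] := lead_trues (s w).
case: r e hr sz => [|[] r] e // hr sz; first by rewrite e cats0 mem_nseq andbF.
move=> _; have := @run_while_shift _ _ false _ _ _ hw e hr; set s1 := upd _ _ _ => h1.
rewrite e' cats0 in s1 h1.
have ew : s1 w = false :: r by rewrite /s1; solve_store.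
apply: run_conv.
- apply: run_seq h1 _; apply: run_seq; last by apply: run_mv; rewrite eq_sym.
  apply: (run_if (T := 1 + 1)); rewrite ew /=.
  by apply: run_seq; [apply: run_pop | apply: run_push].
- rewrite {1}e incr_trues /= -catrev_nseq; rewrite /s1; solve_store.
- rewrite -sz (_ : upd _ _ _ w' = nseq j false); last by rewrite /s1; solve_store.
  by rewrite size_nseq; clear; lia.
Qed.

(** What [c] leaves on [w] ends up at the most significant end: [Push w true] lengthens the counter,
    while [Pop g] lets it wrap around and lowers a flag. *)
Lemma run_inc_over (w w' : nat) c (s s2 : store) T : w != w' -> s w' = [::] ->
  false \notin s w -> 
  run c (upd (upd s w [::]) w' (nseq (size (s w)) false)) s2 T ->
  s2 w' = nseq (size (s w)) false ->
  run (inc w w' c) s (upd (upd s2 w' [::]) w (nseq (size (s w)) false ++ s2 w))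
    (10 * size (s w) + 10 + T).
Proof.
move=> hw e'; have [j [r [e hr sz]]] := lead_trues (s w).
case: r e hr sz => [|[] r] e // hr sz; last by rewrite e mem_cat mem_head orbT.
rewrite cats0 in e; rewrite e size_nseq => _ hc es2.
have e0 : s w = nseq j true ++ [::] by rewrite cats0.
have := @run_while_shift _ _ false _ _ _ hw e0 hr; rewrite e' cats0 => h1.
apply: run_conv.
- apply: run_seq h1 _; apply: run_seq; last by apply: run_mv; rewrite eq_sym.
  by apply: (run_if (T := T)); rewrite (_ : upd _ _ _ w = [::]) /=; [exact: hc | solve_store].
- by rewrite es2 catrev_nseq; solve_store.
- by rewrite es2 size_nseq; clear; lia.
Qed.

Lemma run_incr (w w' : nat) (s : store) : w != w' -> s w' = [::] ->
  run (inc w w' (Push w true)) s (upd s w (incr (s w))) (10 * size (s w) + 11).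
Proof.
move=> hw e'; case: (boolP (false \in s w)) => h.
  by apply: run_conv; [apply: run_inc => // | by [] | rewrite leq_add2l].
apply: run_conv.
- by apply: (run_inc_over hw e' h); [exact: run_push | solve_store].
- have [j [r [e hr sz]]] := lead_trues (s w).
  case: r e hr sz => [|[] r] e // hr sz; last by rewrite e mem_cat mem_head orbT in h.
  by rewrite e cats0 -[nseq j true]cats0 incr_trues cats0 size_nseq /=; solve_store.
- by rewrite addn1 -addnS.
Qed.

Lemma run_inc_flag (w w' g : nat) (s : store) : uniq [:: w; w'; g] -> s w' = [::] ->
  false \notin s w ->
  run (inc w w' (Pop g)) s
    (upd (upd s w (nseq (size (s w)) false)) g (behead (s g))) (10 * size (s w) + 11).
Proof.
move=> hu e' h; split_neq; apply: run_conv.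
- by apply: (run_inc_over _ e' h); [by [] | exact: run_pop | solve_store].
- rewrite (_ : upd _ g _ w = [::]); last by solve_store.
  by rewrite cats0; solve_store.
- by rewrite addn1 -addnS.
Qed.

(** * The reduction as a stack program *)

Lemma orv_cat t a r x : size r = size a -> orv t a (r ++ x) = orv t a r.
Proof. by elim: a r => [|b a IH] [|c r] //= [/IH ->]. Qed.

Lemma inter_cat a r x : size r = size a -> inter a (r ++ x) = inter a r.
Proof. by elim: a r => [|b a IH] [|c r] //= [/IH ->]. Qed.

Lemma size_incr c : size (incr c) <= (size c).+1.
Proof. by elim: c => // -[] c IH. Qed.

(* Registers: 0/1 instance rows, 2/3 characteristic vector of the used elements, 4 [1^k],
   5/6 binary counter, 7/8 [1^l], 9/10 [1^(s l)], 11/12 [1^d], 13/14 candidate word,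
   15 loop flag, 16 conflict flag, 17/18 accepted words, 19/20 current point, 21 output. *)
Definition read_header : cmd :=
  Seq (Seq (While is_one 0 (Seq (Pop 0) (Push 2 false))) (Pop 0))
      (Seq (While is_one 0 (Seq (Pop 0) (Push 4 true))) (Pop 0)).

Lemma run_read_header n k X :
  run read_header (input_store (unary n ++ unary k ++ X))
    (nth [::] [:: X; [::]; nseq n false; [::]; nseq k true])
    (4 * n + 4 * k + 4).
Proof.
have -> : input_store (unary n ++ unary k ++ X) =
          nth [::] [:: unary n ++ unary k ++ X].
  by apply: funext => -[|[|i]] //=.
apply: run_conv.
- by apply: run_seq; apply: run_unary.
- by rewrite !upd_nth /= !cats0.
- by lia.
Qed.

(** Counting the rows in binary yields the logarithm of their number as the height of a stack,
    without arithmetic. *)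
Definition scan_rows : cmd :=
  While nonempty 0 (Seq (mergeb true 2 3 0 1) (inc 5 6 (Push 5 true))).

Lemma run_scan_rows rows acc u K c :
  0 < size u -> all (fun r => size r == size u) rows ->
  run scan_rows (nth [::] [:: flatten rows; acc; u; [::]; K; c])
    (nth [::] [:: [::]; catrev (flatten rows) acc; foldl (orv true) u rows; [::]; K;
                  iter (size rows) incr c])
    (size rows * (18 * size u + 10 * (size c + size rows) + 20) + 1).
Proof.
move=> hu; elim: rows acc u c hu => [|r rows IH] acc u c hu /=.
  by move=> _; apply: run_conv; [apply: run_while_stop | |].
case/andP=> /eqP hr hrows.
have hne : nonempty (ohead (r ++ flatten rows)).
  by case: (r) hr => [|//] e; rewrite -e in hu.
set s0 : store := nth _ _.
have h1 := @run_mergeb true 2 3 0 1 s0 isT.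
rewrite /s0 /= size_cat hr leq_addr in h1; have {h1} := h1 isT erefl.
rewrite orv_cat // -hr drop_size_cat // take_size_cat // !upd_nth /= => h1.
apply: run_conv.
- apply: run_while_step; first exact: hne.
    apply: run_seq; first exact: h1.
    by apply: run_incr.
  rewrite !upd_nth /=; apply: IH; first by rewrite size_orv.
  by apply/allP => x /(allP hrows)/eqP ->; rewrite size_orv.
- by rewrite !catrevE rev_cat catA -iterSr.
- by have := size_incr c; rewrite size_orv hr /=; nia.
Qed.

(** A counter with value e has one bit more than the integer part of log2 e, whence the initial
    [Pop 5]; each remaining bit contributes one unit of l. *)
Definition scale (s q : nat) : cmd :=
  Seq (Pop 5)
    (While nonempty 5 (Seq (Pop 5) (Seq (Push 7 true) (Seq (pushes 9 (nseq s true))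
      (Seq (pushes 11 (nseq q true)) (pushes 13 (nseq q false))))))).

Lemma run_scale s q X U K b c :
  let l := size c in
  run (scale s q) (nth [::] [:: X; [::]; U; [::]; K; b :: c])
    (nth [::] [:: X; [::]; U; [::]; K; [::]; [::]; nseq l true; [::];
                  nseq (l * s) true; [::]; nseq (l * q) true; [::]; nseq (l * q) false])
    (l * (s + q + q + 5) + 2).
Proof.
have main : forall l0, run (While nonempty 5 (Seq (Pop 5) (Seq (Push 7 true)
    (Seq (pushes 9 (nseq s true))
      (Seq (pushes 11 (nseq q true)) (pushes 13 (nseq q false)))))))
   (nth [::] [:: X; [::]; U; [::]; K; c; [::]; nseq l0 true; [::];
                  nseq (l0 * s) true; [::]; nseq (l0 * q) true; [::]; nseq (l0 * q) false])
   (nth [::] [:: X; [::]; U; [::]; K; [::]; [::]; nseq (size c + l0) true; [::];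
                  nseq ((size c + l0) * s) true; [::]; nseq ((size c + l0) * q) true; [::];
                  nseq ((size c + l0) * q) false])
   (size c * (s + q + q + 5) + 1).
  elim: c => [|x c IH] l0.
    by apply: run_conv; [apply: run_while_stop | |].
  apply: run_conv.
  - apply: run_while_step; first by [].
      apply: run_seq; first exact: run_pop.
      apply: run_seq; first exact: run_push.
      apply: run_seq; first exact: run_pushes.
      by apply: run_seq; apply: run_pushes.
    rewrite !upd_nth /= -!nseqD -!mulSn -[true :: nseq l0 true]/(nseq l0.+1 true).
    exact: IH.
  - by rewrite !addnS.
  - by rewrite !size_nseq /=; lia.
apply: run_conv.
- apply: run_seq; first exact: run_pop.
  rewrite upd_nth /=; move: (main 0); rewrite !mul0n !addn0.
  have -> : nth [::] [:: X; [::]; U; [::]; K; c; [::]; nseq 0 true; [::]; nseq 0 true; [::];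
                     nseq 0 true; [::]; nseq 0 false] = nth [::] [:: X; [::]; U; [::]; K; c].
    by apply: funext => i; do 15?[case: i => [|i] //=].
  exact.
- by [].
- by lia.
Qed.

Lemma inter_le_size a r : inter a r <= size a.
Proof. by elim: a r => //= b a IH r; have := IH (behead r); lia. Qed.

(** The weight is written as an overlap with the all-ones word, so that [intersect] tests it as
    well. *)
Definition acceptable (l p : nat) (w : seq bool) (ws : seq (seq bool)) : bool :=
  (inter w (nseq (size w) true) == p) && all (fun v => inter w v <= l) ws.

(** Register 16 receives units for a weight above p, a weight below p, and overlaps above l; the
    word is acceptable when it stays empty. *)
Definition check_word : cmd :=
  Seq (intersect 13 14 11 12 9 10 16) (Seq (If is_one 9 (Push 16 true) Skip)
    (Seq (mv 10 9) (Seq (mv 12 11) (Seq (mv 14 13)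
      (Seq (While nonempty 17 (Seq (intersect 13 14 17 18 7 8 16) (Seq (mv 14 13) (mv 8 7))))
         (mv 18 17)))))).

Section Greedy.

Variables (X U K : seq bool) (l p d : nat).
Hypothesis d_gt0 : 0 < d.

Definition greedy_store (w G F R R' : seq bool) : store :=
  nth [::] [:: X; [::]; U; [::]; K; [::]; [::]; nseq l true; [::]; nseq p true; [::];
     nseq d true; [::]; w; [::]; G; F; R; R'].

Lemma catrev_minn c m : catrev (nseq (minn c m) true) (nseq (m - c) true) = nseq m true.
Proof. by rewrite catrev_nseq -nseqD; congr nseq; lia. Qed.

(** The number of flags matters only through its vanishing and through an upper bound, the latter
    for the time of [clear_stack]. *)
Lemma run_compare w G f ws acc : size w = d -> all (fun v => size v == d) ws ->
  exists2 f', (f' == 0) = (f == 0) && all (fun v => inter w v <= l) ws /\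
              f' <= f + size ws * d &
  run (While nonempty 17 (Seq (intersect 13 14 17 18 7 8 16) (Seq (mv 14 13) (mv 8 7))))
    (greedy_store w G (nseq f true) (flatten ws) acc)
    (greedy_store w G (nseq f' true) [::] (catrev (flatten ws) acc))
    (size ws * (26 * d + 6 * l + 10) + 1).
Proof.
move=> hw; elim: ws f acc => [|v ws IH] f acc /=.
  move=> _; exists f; first by rewrite andbT addn0.
  by apply: run_conv; [apply: run_while_stop | |].
case/andP=> /eqP hv hws.
have [f' [h1 h2] h3] := IH (inter w v - l + f) (catrev v acc) hws.
exists f'; first split.
- by rewrite h1 addn_eq0 subn_eq0 andbA [(f == 0) && _]andbC.
- by apply: leq_trans h2 _; have := inter_le_size w v; rewrite hw; lia.
set s0 := greedy_store _ _ _ _ _.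
have := @run_intersect 13 14 17 18 7 8 16 s0 l isT.
rewrite /s0 /= size_cat hv hw leq_addr => /(_ isT erefl).
rewrite inter_cat ?hw // -{1 2}hv drop_size_cat // take_size_cat // !upd_nth /= => h4.
apply: run_conv.
- apply: run_while_step.
  + by rewrite /=; case: (v) hv d_gt0 => [<-|].
  + apply: run_seq; first exact: h4.
    apply: run_seq; first exact: run_mv.
    by apply: run_mv.
  rewrite !upd_nth /= [catrev (nseq _ _) [::]]catrev_nseq cats0 catrev2 catrev_minn -nseqD.
  exact: h3.
- by rewrite !catrevE rev_cat catA.
- by rewrite !catrevE !size_cat !size_rev !size_nseq /= hw /=; clear; lia.
Qed.

Lemma run_check_word w G ws : size w = d -> all (fun v => size v == d) ws ->
  exists2 f, (f == 0) = acceptable l p w ws /\ f <= (size ws).+1 * d + 1 &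
  run check_word (greedy_store w G [::] (flatten ws) [::])
    (greedy_store w G (nseq f true) (flatten ws) [::])
    ((size ws).+1 * (32 * d + 6 * l + 10) + 6 * p + 10).
Proof.
move=> hw hws; pose c := inter w (nseq d true).
have hc : c <= d by rewrite -hw inter_le_size.
have [f' [h1 h2] h3] := run_compare G ((c < p) + (c - p)) [::] hw hws.
exists f'; first split.
- rewrite h1 /acceptable hw -/c; congr (_ && _).
  by clear; lia.
- by apply: leq_trans h2 _; clear -hc; rewrite mulSn; lia.
set s0 := greedy_store _ _ _ _ _.
have := @run_intersect 13 14 11 12 9 10 16 s0 p isT.
rewrite /s0 /= size_nseq hw => /(_ (leqnn _) erefl).
rewrite drop_oversize ?size_nseq // take_oversize ?size_nseq // !upd_nth /= -/c
  !catrev_nseq !cats0 => h4.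
have h5 : run (If is_one 9 (Push 16 true) Skip)
   (nth [::] [:: X; [::]; U; [::]; K; [::]; [::]; nseq l true; [::]; nseq (p - c) true;
      nseq (minn c p) true; [::]; nseq d true; [::]; catrev w [::]; G; nseq (c - p) true;
      flatten ws; [::]])
   (nth [::] [:: X; [::]; U; [::]; K; [::]; [::]; nseq l true; [::]; nseq (p - c) true;
      nseq (minn c p) true; [::]; nseq d true; [::]; catrev w [::]; G;
      nseq ((c < p) + (c - p)) true; flatten ws; [::]]) 3.
  apply: (run_if (T := 1)) => /=; rewrite -subn_gt0; case: (p - c) => [|m] /=.
    by apply: run_conv; [exact: run_skip | |].
  by apply: run_conv; [exact: run_push | rewrite upd_nth |].
apply: run_conv.
- apply: run_seq; first exact: h4.
  apply: run_seq; first exact: h5.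
  apply: run_seq; first exact: run_mv.
  apply: run_seq; first exact: run_mv.
  apply: run_seq; first exact: run_mv.
  rewrite !upd_nth /= catrev_minn catrev2 catrev_nseq cats0.
  by apply: run_seq; [exact: h3 | exact: run_mv].
- by rewrite /greedy_store !upd_nth /= catrev2.
- rewrite upd_nth /= catrevE !size_cat !size_rev !size_nseq /= hw.
  have -> : size (flatten ws) = size ws * d.
    by elim: ws hws {h1 h2 h3 h4 h5 s0} => //= v ws IH /andP[/eqP hv /IH e]; rewrite size_cat hv e mulSn.
  have h6 : minn c p <= p by exact: geq_minr.
  by clear -h6; rewrite !mulSn; lia.
Qed.

Definition append_word : cmd :=
  Seq (mv 13 14)
    (While nonempty 14
      (If is_one 14 (Seq (Pop 14) (Seq (Push 13 true) (Push 17 true)))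
                    (Seq (Pop 14) (Seq (Push 13 false) (Push 17 false))))).

Lemma run_append_word w G F R R' : size w = d ->
  run append_word (greedy_store w G F R R') (greedy_store w G F (w ++ R) R') (14 * d + 2).
Proof.
move=> hw.
have main : forall v a R, run (While nonempty 14
      (If is_one 14 (Seq (Pop 14) (Seq (Push 13 true) (Push 17 true)))
                    (Seq (Pop 14) (Seq (Push 13 false) (Push 17 false)))))
   (nth [::] [:: X; [::]; U; [::]; K; [::]; [::]; nseq l true; [::]; nseq p true; [::];
     nseq d true; [::]; a; v; G; F; R; R'])
   (nth [::] [:: X; [::]; U; [::]; K; [::]; [::]; nseq l true; [::]; nseq p true; [::];
     nseq d true; [::]; catrev v a; [::]; G; F; catrev v R; R'])
   (8 * size v + 1).
  elim=> [|b v IH] a R0; first by apply: run_conv; [exact: run_while_stop | |].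
  apply: run_conv.
  - apply: run_while_step (IH (b :: a) (b :: R0)); first by [].
    apply: (run_if (T := 1 + (1 + 1))) => /=; case: b.
      apply: run_conv; first by apply: run_seq; [exact: run_pop |
        by apply: run_seq; apply: run_push].
        by rewrite !upd_nth.
      by [].
    apply: run_conv; first by apply: run_seq; [exact: run_pop |
        by apply: run_seq; apply: run_push].
      by rewrite !upd_nth.
    by [].
  - by [].
  - by rewrite /=; lia.
apply: run_conv.
- apply: run_seq; first exact: run_mv.
  rewrite !upd_nth /=; exact: main.
- by rewrite /greedy_store /= catrev2 !catrevE cats0 revK.
- by rewrite /= catrevE cats0 size_rev hw; lia.
Qed.

Definition greedy (cands acc : seq (seq bool)) : seq (seq bool) :=
  foldl (fun acc w => if acceptable l p w acc then w :: acc else acc) acc cands.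

(** The candidate in register 13 doubles as a binary counter; its overflow pops register 15 and ends
    the search. *)
Definition greedy_loop : cmd :=
  While nonempty 15 (Seq check_word
    (Seq (If nonempty 16 (clear_stack 16) append_word) (inc 13 14 (Pop 15)))).

(** On an all-ones word [incr] would change the length; the first condition excludes this
    overflow. *)
Definition next_word (a b : seq bool) : bool := (false \in a) && (b == incr a).

Lemma run_greedy_loop w cands acc : path next_word w cands ->
  false \notin last w cands -> all (fun v => size v == d) (w :: cands) ->
  all (fun v => size v == d) acc ->
  run greedy_loop (greedy_store w [:: true] [::] (flatten acc) [::])
    (greedy_store (nseq d false) [::] [::] (flatten (greedy (w :: cands) acc)) [::])
    ((size cands).+1 * ((size acc + size cands + 1) * (50 * d + 6 * l + 30)
       + 24 * d + 6 * p + 60) + 1).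
Proof.
elim: cands w acc => [|v cands IH] w acc hp hl /= /andP[/eqP hw hc] ha.
all: have [f [hf1 hf2] hf3] := run_check_word [:: true] hw ha.
all: have h2 : run (If nonempty 16 (clear_stack 16) append_word)
    (greedy_store w [:: true] (nseq f true) (flatten acc) [::])
    (greedy_store w [:: true] [::]
       (flatten (if acceptable l p w acc then w :: acc else acc)) [::])
    ((size acc).+1 * (3 * d) + 14 * d + 10).
1,3: apply: run_conv;
  [apply: (run_if (T := (size acc).+1 * (3 * d) + 14 * d + 8)) | by [] | by clear; lia].
1,2: rewrite -hf1 /=; case: (f) hf2 => [|m] hm /=; apply: run_conv;
  [exact: run_append_word | by [] | by clear; lia | exact: run_clear_stack | by rewrite upd_nth
  | by clear -hm; rewrite /= size_nseq; lia].
- apply: run_conv.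
  + apply: run_while_step; first by [].
      apply: run_seq; first exact: hf3.
      apply: run_seq; first exact: h2.
      by apply: run_inc_flag.
    by apply: run_while_stop; rewrite !upd_nth.
  + by rewrite !upd_nth /= hw.
  + by rewrite /= hw; clear; lia.
- case/andP: hp => /andP[hfw /eqP hv] hp.
  apply: run_conv.
  + apply: run_while_step; first by [].
      apply: run_seq; first exact: hf3.
      apply: run_seq; first exact: h2.
      by apply: run_inc.
    rewrite upd_nth /= -hv; apply: IH => //.
    by case: ifP => // _; rewrite /= hw eqxx.
  + by [].
  + rewrite /= hw.
    (* At most one word is accepted per candidate, so the sum of the two sizes in the time bound
       does not grow along the loop. *)
    have : size (if acceptable l p w acc then w :: acc else acc) <= (size acc).+1.
      by case: ifP.
    set m := size (if _ then _ else _); move: (size acc) (size cands) => x y; clear => h.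
    have : (m + y + 1) * (50 * d + 6 * l + 30) <= (x + y.+1 + 1) * (50 * d + 6 * l + 30).
      by rewrite leq_mul2r; apply/orP; right; lia.
    rewrite (_ : y.+2 = y.+1 + 1); last by lia.
    rewrite mulnDl mul1n.
    set q := 50 * d + 6 * l + 30; set A := (m + y + 1) * q; set B := (x + y.+1 + 1) * q => hAB.
    have : y.+1 * (A + 24 * d + 6 * p + 60) <= y.+1 * (B + 24 * d + 6 * p + 60).
      by rewrite leq_mul2l; apply/orP; right; lia.
    set Y1 := y.+1 * _; set Y2 := y.+1 * _ => hY.
    have : x.+1 * q <= B by rewrite leq_mul2r; apply/orP; right; lia.
    rewrite {2}/q; move: hY; clear => hY hB.
    have : x.+1 * (32 * d + 6 * l + 10) + x.+1 * (3 * d) <= x.+1 * (50 * d + 6 * l + 30).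
      by rewrite -mulnDr leq_mul2l; lia.
    by lia.
Qed.

End Greedy.

(* The union of the words assigned to the elements of [T]; the words [ws] are assigned in
   order to the elements of [U]. *)
Fixpoint row_or (U T : seq bool) (ws : seq (seq bool)) (A : seq bool) : seq bool :=
  match U, T with
  | u :: U', t :: T' =>
      if u then row_or U' T' (behead ws) (orv t A (head [::] ws)) else row_or U' T' ws A
  | _, _ => A
  end.

Lemma size_row_or U T ws A : size (row_or U T ws A) = size A.
Proof.
by elim: U T ws A => [|[] U IH] [|t T] ws A //=; rewrite IH ?size_orv.

Qed.

Definition init_point : cmd :=
  Seq (While nonempty 11 (Seq (shift1 11 12) (Push 19 false))) (mv 12 11).

(** Words lie on register 17 in the order of the used elements, so a used element outside the
    current set must still skip its word: hence the merge with [false]. *)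
Definition emit_bit : cmd :=
  Seq (If is_one 2
         (Seq (shift1 2 3) (If is_one 0 (mergeb true 19 20 17 18) (mergeb false 19 20 17 18)))
         (shift1 2 3))
      (Pop 0).

Definition emit_row : cmd :=
  Seq init_point (Seq (While nonempty 2 emit_bit)
    (Seq (mv 3 2) (Seq (mv 18 17) (mv 19 21)))).

(** The points pile up in reverse on register 21; moving them to the output restores their order,
    and the header is then pushed back to front. *)
Definition emit : cmd :=
  Seq (While nonempty 0 emit_row)
    (Seq (mv 21 0) (Seq (Push 0 false) (Seq (mv 4 0) (Seq (Push 0 false) (mv 11 0))))).

Section Emit.

Variables (K L W w : seq bool) (d : nat).

Definition emit_store (X U U' D D' R R' A O : seq bool) : store :=
  nth [::] [:: X; [::]; U; U'; K; [::]; [::]; L; [::]; W; [::]; D; D'; w; [::];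
     [::]; [::]; R; R'; A; [::]; O].

Lemma run_init_point X U U' R R' O :
  run init_point (emit_store X U U' (nseq d true) [::] R R' [::] O)
    (emit_store X U U' (nseq d true) [::] R R' (nseq d false) O) (13 * d + 2).
Proof.
have main : forall v D' A, run (While nonempty 11 (Seq (shift1 11 12) (Push 19 false)))
    (emit_store X U U' v D' R R' A O)
    (emit_store X U U' [::] (catrev v D') R R' (nseq (size v) false ++ A) O)
    (7 * size v + 1).
  elim=> [|b v IH] D' A; first by apply: run_conv; [exact: run_while_stop | |].
  apply: run_conv.
  - apply: run_while_step (IH (b :: D') (false :: A)); first by [].
    apply: run_conv; first by apply: run_seq; [exact: run_shift1 | exact: run_push].
      by rewrite !upd_nth.
    exact: leqnn.
  - by rewrite cat_nseqS.
  - by rewrite /=; lia.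
apply: run_conv.
- by apply: run_seq; [exact: main | exact: run_mv].
- by rewrite !upd_nth /= catrev2 size_nseq cats0.
- by rewrite /= catrev_nseq cats0 !size_nseq; lia.
Qed.

Lemma run_emit_bits X T U U' ws acc A O : size T = size U -> size A = d ->
  all (fun v => size v == d) ws -> count id U <= size ws ->
  run (While nonempty 2 emit_bit)
    (emit_store (T ++ X) U U' (nseq d true) [::] (flatten ws) acc A O)
    (emit_store X [::] (catrev U U') (nseq d true) [::] (flatten (drop (count id U) ws))
       (catrev (flatten (take (count id U) ws)) acc) (row_or U T ws A) O)
    (size U * (18 * d + 20) + 1).
Proof.
elim: U T U' ws acc A => [|u U IH] [|t T] U' ws acc A //.
  by move=> *; rewrite /= drop0 take0; apply: run_conv; [exact: run_while_stop | |].
case=> hT hA hws hc.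
pose ws1 := if u then behead ws else ws.
pose acc1 := if u then catrev (head [::] ws) acc else acc.
pose A1 := if u then orv t A (head [::] ws) else A.
have h : run emit_bit
    (emit_store ((t :: T) ++ X) (u :: U) U' (nseq d true) [::] (flatten ws) acc A O)
    (emit_store (T ++ X) U (u :: U') (nseq d true) [::] (flatten ws1) acc1 A1 O)
    (18 * d + 15).
  case: u IH hc @ws1 @acc1 @A1 => IH hc ws1 acc1 A1; last first.
    apply: run_conv.
    - apply: run_seq; last exact: run_pop.
      by apply: (run_if (T := 4)); exact: run_shift1.
    - by rewrite !upd_nth.
    - by lia.
  case: ws hws hc @ws1 @acc1 @A1 => [|v ws] //= /andP[/eqP hv hws] hc; rewrite /emit_bit.
  have hdr : drop d (v ++ flatten ws) = flatten ws by rewrite drop_size_cat.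
  have htk : take d (v ++ flatten ws) = v by rewrite take_size_cat.
  apply: run_conv.
  - apply: run_seq; last exact: run_pop.
    apply: (run_if (T := 4 + (18 * d + 2).+2)) => /=.
    apply: run_seq; first exact: run_shift1.
    rewrite !upd_nth /=.
    apply: (run_if (T := 18 * d + 2)) => /=.
    set s0 : store := nth _ _.
    have := @run_mergeb t 19 20 17 18 s0 isT.
    rewrite /s0 /= size_cat hv hA leq_addr => /(_ isT erefl).
    rewrite orv_cat ?hA // hdr htk => h.
    suff -> : (if is_one (Some t) then mergeb true 19 20 17 18 else mergeb false 19 20 17 18) =
      mergeb t 19 20 17 18 by exact: h.
    by case: (t).
  - by rewrite !upd_nth.
  - by lia.
apply: run_conv.
- apply: run_while_step; first by [].
    exact: h.
  apply: IH => //; rewrite /A1 /ws1; case: (u) hc => //=.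
  + by rewrite size_orv.
  + by case: (ws) hws => //= ? ? /andP[].
  + by case: (ws).
- rewrite /ws1 /acc1 /A1; case: (u) hc => //=; case: (ws) => [|v ws'] //= _.
  by rewrite !catrevE rev_cat catA.
- by rewrite /=; lia.
Qed.

Lemma run_emit_row X T U R ws O : size T = size U ->
  all (fun v => size v == d) ws -> count id U <= size ws -> R = flatten ws ->
  run emit_row
    (emit_store (T ++ X) U [::] (nseq d true) [::] R [::] [::] O)
    (emit_store X U [::] (nseq d true) [::] R [::] [::]
       (catrev (row_or U T ws (nseq d false)) O))
    (size U * (18 * d + 26) + 6 * (size ws * d) + 20 * d + 10).
Proof.
move=> hT hws hc ->; apply: run_conv.
- apply: run_seq; first exact: run_init_point.
  apply: run_seq; first by apply: run_emit_bits; rewrite ?size_nseq.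
  apply: run_seq; first exact: run_mv.
  by apply: run_seq; apply: run_mv.
- rewrite !upd_nth /= !catrev2 [catrev (catrev (flatten _) _) _]catrevE
    [catrev (flatten _) _]catrevE cats0 revK.
  by rewrite -flatten_cat cat_take_drop.
- rewrite !upd_nth /= !catrevE !cats0 !size_rev size_row_or size_nseq.
  have : size (flatten (take (count id U) ws)) <= size ws * d.
    have -> : size ws * d = size (flatten ws).
      by elim: ws hws {hc} => //= v ws IH /andP[/eqP hv /IH e]; rewrite size_cat hv -e mulSn.
    by rewrite -{2}(cat_take_drop (count id U) ws) flatten_cat size_cat leq_addr.
  by lia.
Qed.

Lemma run_emit Ts U k ws : K = nseq k true -> 0 < size U ->
  all (fun T => size T == size U) Ts ->
  all (fun v => size v == d) ws -> count id U <= size ws ->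
  exists2 s, s 0 = unary d ++ unary k ++
      flatten [seq row_or U T ws (nseq d false) | T <- Ts] &
  run emit (emit_store (flatten Ts) U [::] (nseq d true) [::] (flatten ws) [::] [::] [::]) s
    (size Ts * (size U * (18 * d + 26) + 6 * (size ws * d) + 26 * d + 15) +
     6 * d + 6 * k + 6).
Proof.
move=> hK hU hTs hws hc.
have main : forall O, run (While nonempty 0 emit_row)
    (emit_store (flatten Ts) U [::] (nseq d true) [::] (flatten ws) [::] [::] O)
    (emit_store [::] U [::] (nseq d true) [::] (flatten ws) [::] [::]
       (catrev (flatten [seq row_or U T ws (nseq d false) | T <- Ts]) O))
    (size Ts * (size U * (18 * d + 26) + 6 * (size ws * d) + 20 * d + 15) + 1).
  elim: Ts hTs => [|T Ts IH] /= hTs O; first by apply: run_conv; [exact: run_while_stop | |].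
  case/andP: hTs => /eqP hT hTs; apply: run_conv.
  - apply: run_while_step; last exact: (IH hTs (catrev (row_or U T ws (nseq d false)) O)).
      by rewrite /=; case: (T) hT hU => [<-|].
    by apply: run_emit_row.
  - by rewrite !catrevE rev_cat catA.
  - by clear; lia.
set P := flatten [seq row_or U T ws (nseq d false) | T <- Ts] in main *.
have hP : size P = size Ts * d.
  rewrite /P; elim: (Ts) => //= T Ts' IH.
  by rewrite size_cat IH size_row_or size_nseq mulSn.
eexists; last first.
  apply: run_conv.
  - apply: run_seq; first exact: main.
    apply: run_seq; first exact: run_mv.
    apply: run_seq; first exact: run_push.
    apply: run_seq; first exact: run_mv.
    apply: run_seq; first exact: run_push.
    exact: run_mv.
  - by [].
  - rewrite !upd_nth /= hK !catrevE !cats0 !size_rev !size_nseq hP.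
    by rewrite !mulnDr; lia.
by rewrite !upd_nth /= catrev2 hK !catrev_nseq /unary !cat_rcons.
Qed.

End Emit.

(** * The list of all words, and the invariants of the greedy code *)

Fixpoint all_words (d : nat) : seq (seq bool) :=
  if d is d'.+1 then flatten [seq [:: false :: w; true :: w] | w <- all_words d']
  else [:: [::]].

Lemma mem_all_words d w : (w \in all_words d) = (size w == d).
Proof.
elim: d w => [|d IH] w; first by rewrite inE size_eq0.
apply/flatten_mapP/idP => [[v]|].
  by rewrite IH !inE => /eqP <- /orP[] /eqP ->.
case: w => // b w; rewrite eqSS => hw; exists w; first by rewrite IH.
by rewrite !inE !eqseq_cons eqxx; case: b.
Qed.

Lemma size_all_words d : size (all_words d) = 2 ^ d.
Proof.
elim: d => //= d IH.
have -> : forall l : seq (seq bool),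
    size (flatten [seq [:: false :: w; true :: w] | w <- l]) = 2 * size l.
  by elim=> //= w l ->; lia.
by rewrite IH expnS.
Qed.

(** The head of a word is its least significant bit, so listing both heads for each tail follows the
    order of the counter. *)
Lemma all_words_enum d : exists2 ws, all_words d = nseq d false :: ws &
  path next_word (nseq d false) ws /\ last (nseq d false) ws = nseq d true.
Proof.
elim: d => [|d [ws /= -> [hp hl]]]; first by exists [::].
exists ((true :: nseq d false) :: flatten [seq [:: false :: w; true :: w] | w <- ws]) => //.
rewrite /= -{}hl.
move: (nseq d false) hp => w hp.
have step v : next_word (false :: v) (true :: v) by rewrite /next_word mem_head /= eqxx.
elim: ws w hp => [|v ws IH] w /=; first by rewrite step.
case/andP=> /andP[hw /eqP hv] /IH[hp hl]; rewrite hl step; split => //=.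
by apply/andP; split; [rewrite /next_word inE hw /= hv | exact: hp].
Qed.

Lemma iter_incr e : 0 < e ->
  let c := iter e incr [::] in
  c != [::] /\ 2 ^ (size c).-1 <= e < 2 ^ size c.
Proof.
pose val := foldr (fun (b : bool) v => b + 2 * v) 0.
have val_incr c : val (incr c) = (val c).+1.
  by elim: c => // -[] c /= IH; rewrite ?IH; lia.
(* The invariant says that the top bit is set, and holds by default for the empty counter; it makes
   the length determined by the value. *)
have last_incr c : last true c -> last true (incr c).
  elim: c => // -[] c IH /=; last by case: c {IH}.
  by move=> h; have {IH} := IH h; case: c {h} => [|[] c].
have bounds c : c != [::] -> last true c -> 2 ^ (size c).-1 <= val c < 2 ^ size c.
  elim: c => // b c IH _ /=; case: c IH => [|b' c] IH /=; first by case: b {IH}.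
  by move=> /(IH isT); rewrite /= !expnS; case: b; lia.
have hval n : val (iter n incr [::]) = n by elim: n => //= n IH; rewrite val_incr IH.
have hlast n : last true (iter n incr [::]) by elim: n => //= n IH; apply: last_incr.
move=> he c; have hne : c != [::] by apply: contraTneq he => h; rewrite -(hval e) -/c h.
by split => //; have := bounds c hne (hlast e); rewrite (hval e : val c = e).
Qed.

Section GreedyCode.

Variables (l p d : nat).

Definition code_ok (ws : seq (seq bool)) : Prop :=
  [/\ all (fun v => size v == d) ws,
      all (fun v => inter v (nseq d true) == p) ws
    & forall i j, i < j < size ws -> inter (nth [::] ws i) (nth [::] ws j) <= l].

Lemma code_ok_greedy cands acc : all (fun v => size v == d) cands ->
  code_ok acc -> code_ok (greedy l p cands acc).
Proof.
elim: cands acc => //= w cands IH acc /andP[/eqP hw hc] hacc; apply: IH => //.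
case: ifP => // /andP[h1 h2]; case: hacc => [a1 a2 a3]; split => /=.
- by rewrite hw eqxx.
- by rewrite -hw h1 hw.
- move=> [|i] [|j] //=; last by rewrite !ltnS; apply: a3.
  by rewrite ltnS => hj; apply: (allP h2); apply: mem_nth.
Qed.

Lemma sub_greedy cands acc : {subset acc <= greedy l p cands acc}.
Proof.
elim: cands acc => [|w cands IH] acc v hv //=; apply: IH.
by case: ifP => // _; rewrite inE hv orbT.
Qed.

Lemma size_greedy cands acc : size (greedy l p cands acc) <= size acc + size cands.
Proof.
elim: cands acc => [|w cands IH] acc /=; first by rewrite addn0.
by apply: leq_trans (IH _) _; case: ifP => _ /=; lia.
Qed.

Lemma inter_self w : inter w w = inter w (nseq (size w) true).
Proof. by elim: w => //= -[] w ->. Qed.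

(** An accepted [w] meets itself in [p > l] positions; a rejected one of weight [p] was refused
    because of a word accepted earlier. *)
Lemma greedy_maximal cands acc w : w \in cands -> inter w (nseq (size w) true) = p ->
  l < p -> has (fun v => l < inter w v) (greedy l p cands acc).
Proof.
move=> hw hp hlp; elim: cands acc hw => //= v cands IH acc.
rewrite inE => /orP[/eqP <-|/IH]; last exact.
case: (boolP (acceptable l p w acc)) => h.
  apply/hasP; exists w; last by rewrite inter_self hp.
  by apply: sub_greedy; rewrite mem_head.
move: h; rewrite /acceptable hp eqxx /= => /allPn[v' hv' h].
by apply/hasP; exists v'; [apply: sub_greedy | rewrite ltnNge].
Qed.

End GreedyCode.

(** * The complete reduction program and its running time *)

Definition reduction (s q : nat) : cmd :=
  Seq read_header (Seq scan_rows (Seq (mv 1 0) (Seq (scale s q)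
    (Seq (Push 15 true) (Seq greedy_loop emit))))).

(** The sum is nested like the stages of [reduction], so the final comparison is termwise
    monotonicity. *)
Definition reduction_time (s q m : nat) : nat :=
  4 * m + 4 * m + 4 + (m * (18 * m + 10 * m + 20) + 1 + (6 * m + 1 +
  (m * (s + q + q + 5) + 2 + (1 + (
  m ^ q * ((m ^ q + 1) * (50 * (m * q) + 6 * m + 30) + 24 * (m * q) + 6 * (m * s) + 60) + 1 +
  (m * (m * (18 * (m * q) + 26) + 6 * (m ^ q * (m * q)) + 26 * (m * q) + 15)
   + 6 * (m * q) + 6 * m + 6)))))).

Lemma poly_le_reduction_time s q : poly_le (reduction_time s q).
Proof.
rewrite /reduction_time.
repeat first [exact: poly_le_id | exact: poly_le_const | apply: poly_le_add
  | apply: poly_le_mul | apply: poly_le_exp].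
Qed.

Ltac pad_store := let j := fresh "j" in apply: funext => j; do 24?[case: j => [|j] //=].

Lemma run_reduction s q n k rows :
  let X := flatten rows in
  let U := foldl (orv true) (nseq n false) rows in
  let l := (size (iter (size rows) incr [::])).-1 in
  let d := l * q in
  let ws := greedy l (l * s) (all_words d) [::] in
  let x := unary n ++ unary k ++ X in
  0 < n -> 0 < size rows -> 0 < d -> all (fun r => size r == n) rows ->
  count id U <= size ws ->
  exists2 st, st 0 = unary d ++ unary k ++ flatten [seq row_or U T ws (nseq d false) | T <- rows]
    & run (reduction s q) (input_store x) st (reduction_time s q (size x)).
Proof.
move=> X U l d ws x hn he hd hrows hc.
have [] := iter_incr he; rewrite -/l; case eC: (iter _ _ _) @l @d @ws hd hc => [//|b c] /= .
move=> hd hc _ /andP[hle _].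
set l := size c in hd hc hle *; set d := l * q in hd hc *.
set ws := greedy _ _ _ _ in hc *.
have szU : size U = n.
  rewrite /U -{2}(size_nseq n false); elim: (rows) (nseq n false) => //= r rs IH u.
  by rewrite IH size_orv.
have [cands ecands [hp hl]] := all_words_enum d.
have hcands : all (fun v => size v == d) (all_words d).
  by apply/allP => v; rewrite mem_all_words.
have szc : (size cands).+1 = 2 ^ d by rewrite -size_all_words ecands.
have [hws _ _] : code_ok l (l * s) d ws.
  by apply: code_ok_greedy => //; split => // i j; rewrite ltn0 andbF.
have szx : [/\ n <= size x, k <= size x, size X <= size x & size rows <= size x].
  rewrite /x !size_cat /unary !size_rcons !size_nseq; split; try by lia.
  have : size rows <= size X.
    rewrite /X; elim: (rows) hrows => //= r rs IH /andP[/eqP hr /IH h].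
    by rewrite size_cat hr; lia.
  by lia.
case: szx => szn szk szX sze.
have hl1 : l <= size x by apply: leq_trans sze; apply: leq_trans hle; apply/ltnW/ltn_expl.
have hd1 : d <= size x * q by rewrite leq_mul2r hl1 orbT.
(* The exhaustive search is affordable here: [2 ^ d = (2 ^ l) ^ q], and [2 ^ l] is at most the
   number of rows. *)
have hN : 2 ^ d <= size x ^ q.
  rewrite /d expnM; case: (q) => // q'; rewrite leq_exp2r //.
  exact: leq_trans sze.
have szws : size ws <= size x ^ q.
  by apply: leq_trans hN; rewrite -size_all_words; apply: size_greedy.
have [st hst h7] : exists2 st, st 0 = unary d ++ unary k ++
      flatten [seq row_or U T ws (nseq d false) | T <- rows] &
    run emit (emit_store (nseq k true) (nseq l true) (nseq (l * s) true) (nseq d false)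
       X U [::] (nseq d true) [::] (flatten ws) [::] [::] [::]) st
     (size rows * (size U * (18 * d + 26) + 6 * (size ws * d) + 26 * d + 15) +
     6 * d + 6 * k + 6).
  by apply: run_emit => //; rewrite szU.
exists st => //.
have h6 := @run_greedy_loop X U (nseq k true) l (l * s) d hd (nseq d false) cands [::] hp.
have {}h6 := h6 _ _ isT.
rewrite hl mem_nseq andbF -ecands -/ws in h6; have {}h6 := h6 isT hcands.
have hX : catrev (catrev X [::]) [::] = X by exact: catrev2.
apply: run_conv.
- apply: run_seq; first exact: run_read_header.
  apply: run_seq.
    rewrite (_ : nth _ _ = nth [::] [:: X; [::]; nseq n false; [::]; nseq k true; [::]]);
      last by pad_store.
    by apply: run_scan_rows; rewrite size_nseq.
  apply: run_seq; first exact: run_mv.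
  rewrite !upd_nth /= hX eC -/U.
  apply: run_seq; first exact: run_scale.
  apply: run_seq; first exact: run_push.
  rewrite !upd_nth /=.
  apply: run_seq.
    rewrite (_ : nth _ _ = greedy_store X U (nseq k true) l (l * s) d (nseq d false)
      [:: true] [::] [::] [::]); last by rewrite /greedy_store; pad_store.
    exact: h6.
  rewrite (_ : greedy_store _ _ _ _ _ _ _ _ _ _ _ = emit_store (nseq k true) (nseq l true)
    (nseq (l * s) true) (nseq d false) X U [::] (nseq d true) [::] (flatten ws)
    [::] [::] [::]); last first.
    by rewrite /greedy_store /emit_store; pad_store.
  exact: h7.
- by [].
- rewrite /reduction_time /= catrevE cats0 size_rev size_nseq szU szc add0n.
  have sz1 : size cands + 1 <= size x ^ q + 1.
    by rewrite leq_add2r ltnW // szc.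
  repeat first [exact: leqnn | assumption | apply: leq_add | apply: leq_mul].
Qed.

(** * Size of the greedy code *)

Definition one_hot (Q c : nat) : seq bool := [seq i == c | i <- iota 0 Q].

(** A product family of words of weight [N]: overlaps with a fixed word split into independent
    contributions of the blocks. It serves only to bound from below the code found among all
    words. *)
Fixpoint hot_words (Q N : nat) : seq (seq bool) :=
  if N is N'.+1 then [seq one_hot Q c ++ w | c <- iota 0 Q, w <- hot_words Q N']
  else [:: [::]].

Lemma inter_catl a b v : inter (a ++ b) v = inter a v + inter b (drop (size a) v).
Proof.
elim: a v => [|x a IH] v /=; first by rewrite drop0.
by rewrite IH -addnA; case: v => //= ; case: (size a).
Qed.

Lemma inter_one_hot Q c v : c < Q -> inter (one_hot Q c) v = nth false v c.
Proof.
rewrite /one_hot => hc.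
have h : forall m, inter [seq i == c | i <- iota m Q] v =
    if m <= c < m + Q then nth false v (c - m) : nat else 0.
  elim: Q v {hc} => [|Q IH] v m /=; first by rewrite addn0; case: ltngtP.
  rewrite IH; case: (ltngtP m c) => hm.
  - by rewrite addSnnS; case: ifP => // _; rewrite nth_behead; congr (nat_of_bool (nth _ _ _)); lia.
  - by rewrite addn0.
  - by rewrite -hm subnn addnS ltnS leq_addr addn0; case: (v).
by rewrite h /= add0n hc subn0.
Qed.

Lemma hot_wordsP Q N w : w \in hot_words Q N ->
  size w = N * Q /\ inter w (nseq (N * Q) true) = N.
Proof.
elim: N w => [|N IH] w /=; first by rewrite inE => /eqP ->.
case/allpairsP => -[c v] /= [hc /IH[e1 e2] ->]; rewrite mem_iota in hc.
rewrite size_cat inter_catl size_map size_iota e1 mulSn; split=> //.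
by rewrite inter_one_hot // drop_nseq addKn e2 nth_nseq (leq_trans (_ : c < Q)) ?leq_addr.
Qed.

Lemma size_hot_words Q N : size (hot_words Q N) = Q ^ N.
Proof. by elim: N => //= N IH; rewrite size_allpairs size_iota IH expnS. Qed.

(** With m ones in the block the sum is Q - m + m Q, at most Q (m + 1), hence at most Q 2^m. *)
Lemma sum_one_hot_block Q v :
  \sum_(c <- iota 0 Q) Q ^ (nth false v c) <= Q * 2 ^ count id (take Q v).
Proof.
apply: (@leq_trans (Q * (count id (take Q v)).+1)); last first.
  by rewrite leq_mul2l ltn_expl ?orbT.
have h : forall m, m <= Q ->
    \sum_(c <- iota 0 m) Q ^ (nth false v c) <= m + Q * count id (take m v).
  elim=> [|m IH] hm; first by rewrite big_nil.
  rewrite -{1}addn1 iotaD big_cat /= big_seq1 add0n.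
  have hk : count id (take m v) + nth false v m <= count id (take m.+1 v).
    have [hv|hv] := ltnP m (size v).
      by rewrite (take_nth false) // -cats1 count_cat /= addn0.
    by rewrite nth_default // !take_oversize ?addn0 // ltnW.
  have {IH} := IH (ltnW hm); case: (nth _ _ _) hk; rewrite ?expn0 ?expn1; nia.
by rewrite mulnS; apply: h.
Qed.

(* By Markov's inequality, this exponential moment bounds the number of one-hot words whose
   overlap with [v] is large. *)
Lemma sum_hot_words Q N v :
  \sum_(w <- hot_words Q N) Q ^ inter w v <= Q ^ N * 2 ^ count id v.
Proof.
elim: N v => [|N IH] v /=; first by rewrite big_seq1 expn0 mul1n expn_gt0.
rewrite big_allpairs_dep /=.
apply: (@leq_trans ((\sum_(c <- iota 0 Q) Q ^ (nth false v c)) *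
    (Q ^ N * 2 ^ count id (drop Q v)))).
  rewrite big_distrl /= !big_seq; apply: leq_sum => c; rewrite mem_iota /= => hc.
  rewrite (eq_bigr (fun w => Q ^ (nth false v c) * Q ^ inter w (drop Q v))).
    by rewrite -big_distrr /= leq_mul2l IH orbT.
  by move=> w _; rewrite inter_catl size_map size_iota expnD inter_one_hot.
apply: leq_trans (leq_mul (sum_one_hot_block _ _) (leqnn _)) _.
by rewrite mulnACA -expnS -expnD -count_cat cat_take_drop.
Qed.

(** Double counting of [Q ^ inter w v]: each of the [Q ^ N] hot words contributes at least
    [Q ^ l.+1], and each code word collects at most [Q ^ N * 2 ^ N]. *)
Lemma code_size_bound Q N l (ws : seq (seq bool)) : 0 < Q ->
  all (fun v => count id v == N) ws ->
  (forall w, w \in hot_words Q N -> has (fun v => l < inter w v) ws) ->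
  Q ^ l.+1 <= size ws * 2 ^ N.
Proof.
move=> hQ hN hw.
have hQN : 0 < Q ^ N by rewrite expn_gt0 hQ.
rewrite -(leq_pmul2l hQN).
apply: (@leq_trans (\sum_(w <- hot_words Q N) \sum_(v <- ws) Q ^ inter w v)).
  rewrite -size_hot_words -sum1_size big_distrl /= !big_seq.
  apply: leq_sum => w /hw /hasP[v hv hl]; rewrite mul1n.
  by rewrite (big_rem v) //=; apply: leq_trans (leq_addr _ _); rewrite leq_pexp2l.
rewrite exchange_big /= mulnA -[size ws]sum1_size big_distrr big_distrl /= !big_seq.
apply: leq_sum => v hv; rewrite muln1 -(eqP (allP hN v hv)); exact: sum_hot_words.
Qed.

Lemma inter_true w m : size w <= m -> inter w (nseq m true) = count id w.
Proof. by elim: w m => //= x w IH [//|m] /= h; rewrite IH // andbT. Qed.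

Lemma size_greedy_code l s Q : 0 < Q -> 0 < l -> 1 < s ->
  let ws := greedy l (l * s) (all_words (l * s * Q)) [::] in
  Q ^ l.+1 <= size ws * 2 ^ (l * s).
Proof.
move=> hQ hl hs; set ws := greedy _ _ _ _; apply: code_size_bound => //.
  have [h1 h2 _] : code_ok l (l * s) (l * s * Q) ws.
    apply: code_ok_greedy; last by split => // i j; rewrite ltn0 andbF.
    by apply/allP => v; rewrite mem_all_words.
  apply/allP => v hv; have := allP h2 v hv.
  by rewrite inter_true // (eqP (allP h1 v hv)).
move=> w /hot_wordsP[h1 h2]; apply: greedy_maximal; rewrite ?mem_all_words ?h1 //.
by rewrite ltn_Pmulr.
Qed.

(** * The words as subsets of the coordinates *)

(** For a used element [i], the index of the word that [row_or] deals to it. *)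
Definition rank (U : seq bool) (i : nat) : nat := count id (take i U).

Lemma nth_row_or U T ws A t : size T = size U -> t < size A ->
  nth false (row_or U T ws A) t = nth false A t ||
    has (fun i => [&& nth false U i, nth false T i & nth false (nth [::] ws (rank U i)) t])
      (iota 0 (size U)).
Proof.
elim: U T ws A => [|u U IH] [|b T] ws A //=; first by rewrite orbF.
case=> hT hA; rewrite -[1]addn1 addnC iotaDl has_map /=.
case: u; last by rewrite IH //; congr (_ || _); apply: eq_has.
rewrite IH ?size_orv // nth_orv // -orbA nth0; congr (_ || (_ || _)).
by apply: eq_has => i; rewrite /= /rank /= add1n nth_behead.
Qed.

Lemma rank_lt U i j : i < j -> nth false U i -> rank U i < rank U j.
Proof.
rewrite /rank => hij hi; have hsz : i < size U.
  by apply: contraTT hi; rewrite -leqNgt => h; rewrite nth_default.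
rewrite -(subnKC hij) takeD count_cat (take_nth false) // -cats1 count_cat /= hi; lia.
Qed.

Lemma rank_lt_count U i : nth false U i -> rank U i < count id U.
Proof.
move=> hi; have hsz : i < size U.
  by apply: contraTT hi; rewrite -leqNgt => h; rewrite nth_default.
by have := rank_lt hsz hi; rewrite /rank take_size.
Qed.

Definition word_set (d : nat) (w : seq bool) : {set 'I_d} := [set t : 'I_d | nth false w t].

Lemma inter_sum a v : inter a v = \sum_(t < size a) (nth false a t && nth false v t).
Proof.
elim: a v => [|x a IH] v /=; first by rewrite big_ord0.
rewrite big_ord_recl /= nth0 IH; congr (_ + _).
by apply: eq_bigr => t _; rewrite nth_behead.
Qed.

Lemma card_word_setI d a v : size a = d ->
  #|word_set d a :&: word_set d v| = inter a v.
Proof.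
move=> ha; rewrite inter_sum ha -sum1_card big_mkcond /=; apply: eq_bigr => t _.
by rewrite !inE; case: (_ && _).
Qed.

Lemma card_word_set d a : size a = d -> #|word_set d a| = inter a (nseq d true).
Proof. by move=> ha; rewrite -[in nseq _ _]ha -inter_self -(card_word_setI _ ha) setIid. Qed.

(** * Intersecting families *)

Lemma card_bigcup_le (I T : finType) (A : pred I) (F : I -> {set T}) :
  #|\bigcup_(i | A i) F i| <= \sum_(i | A i) #|F i|.
Proof.
elim/big_rec2: _ => [|i m B _ h]; first by rewrite cards0.
by apply: leq_trans (leq_card_setU _ _) _; rewrite leq_add2l.
Qed.

Lemma bin_le_expn n m : 'C(n, m) <= n ^ m.
Proof.
apply: (@leq_trans (n ^_ m)); first by rewrite -bin_ffact leq_pmulr // fact_gt0.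
by elim: m => // m IH; rewrite ffactnSr expnSr leq_mul // leq_subr.
Qed.

Lemma subset_of_card (T : finType) (A : {set T}) m : m <= #|A| ->
  exists2 S : {set T}, S \subset A & #|S| = m.
Proof.
move=> hm; exists [set x in take m (enum A)].
  by apply/subsetP => x; rewrite inE => /mem_take; rewrite mem_enum.
rewrite cardsE (card_uniqP _) ?take_uniq ?enum_uniq // size_takel //.
by rewrite -cardE.
Qed.

Lemma card_supersets n (S : {set 'I_n}) z :
  #|[set T : {set 'I_n} | S \subset T & #|T| == z]| <= n ^ (z - #|S|).
Proof.
set F := [set T : {set 'I_n} | _ & _].
have hinj : {in F &, injective (fun T : {set 'I_n} => T :\: S)}.
  move=> T1 T2; rewrite !inE => /andP[h1 _] /andP[h2 _] e.
  by rewrite -[T1](setID _ S) -[T2](setID _ S) e (setIidPr h1) (setIidPr h2).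
rewrite -(card_in_imset hinj); apply: leq_trans (bin_le_expn _ _).
have -> : 'C(n, z - #|S|) = #|[set A : {set 'I_n} | #|A| == z - #|S|]|.
  by rewrite card_draws card_ord.
apply/subset_leq_card/subsetP => A.
case/imsetP => T; rewrite !inE => /andP[hS /eqP hT] ->.
by rewrite cardsD (setIidPr hS) hT.
Qed.

Section Intersecting.

Variables (n z m : nat) (F : {set {set 'I_n}}).
Hypothesis F_card : forall T, T \in F -> #|T| = z.
Hypothesis F_meet : forall T T', T \in F -> T' \in F -> m <= #|T :&: T'|.

(** Every member contains one of the at most [2 ^ z] subsets of size [m] of a fixed member. *)
Lemma card_intersecting : #|F| <= 2 ^ z * n ^ (z - m).
Proof.
have [->|[T0 hT0]] := set_0Vmem F; first by rewrite cards0.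
pose G (S : {set 'I_n}) := [set T : {set 'I_n} | S \subset T & #|T| == z].
apply: (@leq_trans #|\bigcup_(S : {set 'I_n} | (S \subset T0) && (#|S| == m)) G S|).
  apply/subset_leq_card/subsetP => T hT.
  have [S hS hm] := subset_of_card (F_meet hT hT0).
  apply/bigcupP; exists S.
    by rewrite hm eqxx andbT (subset_trans hS) // subsetIr.
  by rewrite inE F_card // eqxx andbT (subset_trans hS) // subsetIl.
apply: leq_trans (card_bigcup_le _ _) _.
apply: (@leq_trans (\sum_(S in powerset T0) n ^ (z - m))).
  rewrite big_mkcond [leqRHS]big_mkcond /=; apply: leq_sum => S _.
  rewrite powersetE; case: (S \subset T0) => //=; case: eqP => // <-.
  exact: card_supersets.
by rewrite sum_nat_const card_powerset F_card.
Qed.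

(* Every member of [F] contains some [m]-subset [S] of a fixed member, and, as it also meets a
   fixed member that does not contain [S], one more element of the latter outside [S]. *)
Lemma card_intersecting_no_kernel : m < z ->
  (forall S : {set 'I_n}, #|S| = m -> exists2 T, T \in F & ~~ (S \subset T)) ->
  #|F| <= 2 ^ z * z * n ^ (z - m - 1).
Proof.
move=> hmz hno.
have [->|[T0 hT0]] := set_0Vmem F; first by rewrite cards0.
pose W (S : {set 'I_n}) := odflt set0 [pick T in F | ~~ (S \subset T)].
have WP (S : {set 'I_n}) : #|S| = m -> (W S \in F) /\ ~~ (S \subset W S).
  move=> hS; rewrite /W; case: pickP => [T /andP[] //|h].
  by have [T hT1 hT2] := hno _ hS; have := h T; rewrite hT1 hT2.
pose G (S : {set 'I_n}) := [set T : {set 'I_n} | S \subset T & #|T| == z].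
apply: (@leq_trans #|\bigcup_(S : {set 'I_n} | (S \subset T0) && (#|S| == m))
                      \bigcup_(j | j \in W S :\: S) G (j |: S)|).
  apply/subset_leq_card/subsetP => T hT.
  have [S hS hm] := subset_of_card (F_meet hT hT0).
  have [hW1 hW2] := WP S hm.
  apply/bigcupP; exists S.
    by rewrite hm eqxx andbT (subset_trans hS) // subsetIr.
  have hST : S \subset T by rewrite (subset_trans hS) // subsetIl.
  have /subsetPn[j hj1 hj2] : ~~ (T :&: W S \subset S).
    apply: contra hW2 => h.
    have : T :&: W S == S by rewrite eqEcard h hm F_meet.
    by move/eqP => e; move: (subsetIr T (W S)); rewrite e.
  move: hj1; rewrite inE => /andP[hjT hjW].
  apply/bigcupP; exists j; first by rewrite inE hj2.
  by rewrite inE F_card // eqxx andbT subUset sub1set hjT.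
apply: leq_trans (card_bigcup_le _ _) _.
apply: (@leq_trans (\sum_(S in powerset T0) z * n ^ (z - m - 1))); last first.
  by rewrite sum_nat_const card_powerset F_card // mulnA.
rewrite big_mkcond [leqRHS]big_mkcond /=; apply: leq_sum => S _.
rewrite powersetE; case: (S \subset T0) => //=; case: eqP => // hS.
apply: leq_trans (card_bigcup_le _ _) _.
have [hW1 _] := WP S hS.
apply: (@leq_trans (\sum_(j in W S :\: S) n ^ (z - m - 1))).
  apply: leq_sum => j; rewrite inE => /andP[hj _].
  apply: leq_trans (card_supersets _ _) _.
  by rewrite cardsU1 hj hS add1n -subnDA addn1.
rewrite sum_nat_const leq_mul2r; apply/orP; right.
by rewrite -(F_card hW1); apply/subset_leq_card/subsetDl.
Qed.

End Intersecting.

(** * Distances between the points *)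

Section Points.

Variables (n d p l : nat) (r : 'I_n -> {set 'I_d}) (V : {set 'I_n}).
Hypothesis card_r : forall i, i \in V -> #|r i| = p.
Hypothesis card_rI : forall i j, i \in V -> j \in V -> i != j -> #|r i :&: r j| <= l.

Definition union_set (T : {set 'I_n}) : {set 'I_d} := \bigcup_(i in T) r i.

Lemma union_setP (T : {set 'I_n}) t : reflect (exists2 i, i \in T & t \in r i) (t \in union_set T).
Proof. exact: bigcupP. Qed.

Lemma card_union_setD_le (T S : {set 'I_n}) : T \subset V -> S \subset T ->
  #|union_set T :\: union_set S| + #|union_set S :\: union_set T| <= (#|T| - #|S|) * p.
Proof.
move=> hT hS.
have -> : union_set S :\: union_set T = set0.
  apply/eqP; rewrite setD_eq0; apply/subsetP => t /union_setP[i hi ht].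
  by apply/union_setP; exists i => //; apply: (subsetP hS).
rewrite cards0 addn0; apply: (@leq_trans #|\bigcup_(i in T :\: S) r i|).
  apply/subset_leq_card/subsetP => t; rewrite inE => /andP[h1 /union_setP[i hi hti]].
  apply/bigcupP; exists i => //; rewrite inE hi andbT.
  by apply: contra h1 => h; apply/union_setP; exists i.
apply: leq_trans (card_bigcup_le _ _) _.
rewrite (eq_bigr (fun=> p)); last first.
  by move=> i; rewrite inE => /andP[_ hi]; rewrite card_r // (subsetP hT).
by rewrite sum_nat_const cardsD (setIidPr hS).
Qed.

(** Each element of [T :\: T'] keeps a private part of its word, outside the words of the other
    elements of [T :|: T']. There are at most [2 * z] of these, each removing at most [l] positions,
    and private parts are disjoint. *)
Lemma card_union_setD_ge (T T' : {set 'I_n}) z : T \subset V -> T' \subset V ->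
  #|T| <= z -> #|T'| <= z ->
  #|T :\: T'| * (p - 2 * z * l) <= #|union_set T :\: union_set T'|.
Proof.
move=> hT hT' hz hz'.
pose X i := \bigcup_(j | j \in (T :|: T') :\ i) r j.
(* The default [set0] makes the sets disjoint over all indices, as [partition_disjoint_bigcup]
   requires. *)
pose P i := if i \in T :\: T' then r i :\: X i else set0.
have hP i : i \in T :\: T' -> p - 2 * z * l <= #|P i|.
  move=> hi; rewrite /P hi cardsD.
  have hiT : i \in T by move: hi; rewrite inE => /andP[].
  rewrite card_r ?(subsetP hT) // leq_sub2l //.
  rewrite /X setIC big_distrl /=; apply: leq_trans (card_bigcup_le _ _) _.
  apply: (@leq_trans (\sum_(j in (T :|: T') :\ i) l)).
    apply: leq_sum => j; rewrite !inE => /andP[hj hj']; apply: card_rI => //.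
      by case/orP: hj' => h; [exact: (subsetP hT) | exact: (subsetP hT')].
    exact: (subsetP hT).
  rewrite sum_nat_const leq_mul2r; apply/orP; right.
  apply: leq_trans (subset_leq_card (subsetDl _ _)) _.
  by apply: leq_trans (leq_card_setU _ _) _; lia.
have disj i j : i != j -> [disjoint P i & P j].
  move=> hij; rewrite /P; case: ifP => hi; last by rewrite -setI_eq0 set0I.
  case: ifP => hj; last by rewrite -setI_eq0 setI0.
  rewrite -setI_eq0; apply/eqP/setP => t; rewrite !inE.
  apply/negP => /andP[/andP[h1 h2] /andP[h3 h4]].
  case/negP: h1; apply/bigcupP; exists j => //.
  by move: hj; rewrite !inE eq_sym hij => /andP[_ ->].
apply: (@leq_trans #|\bigcup_i P i|).
  have := @partition_disjoint_bigcup _ _ _ _ addn P (fun=> 1) disj.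
  rewrite sum1_card => ->.
  rewrite (eq_bigr (fun i => #|P i|)); last by move=> i _; rewrite sum1_card.
  rewrite -sum_nat_const [leqRHS](bigID (mem (T :\: T'))) /=.
  by apply: leq_trans (leq_addr _ _); apply: leq_sum => i; apply: hP.
apply/subset_leq_card/subsetP => t /bigcupP[i _]; rewrite /P.
case: ifP => [hi|_]; last by rewrite inE.
rewrite inE => /andP[h1 h2]; rewrite inE.
have /andP[hi1 hi2] : (i \notin T') && (i \in T) by move: hi; rewrite inE.
apply/andP; split; last by apply/union_setP; exists i.
apply: contra h1 => /union_setP[j hj htj]; apply/bigcupP; exists j => //.
rewrite !inE hj orbT andbT; apply: contra hi1 => /eqP <- //.
Qed.

End Points.

(** * Costs of clusterings *)


Lemma sumr_const_seq (V : nmodType) (I : Type) (E : seq I) (x : V) :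
  (\sum_(i <- E) x = x *+ size E)%R.
Proof. by rewrite big_const_seq count_predT iter_addr_0. Qed.

Section Cost.

Variables (R : realType) (n d p l : nat) (r : 'I_n -> {set 'I_d}) (V : {set 'I_n}).
Hypothesis card_r : forall i, i \in V -> #|r i| = p.
Hypothesis card_rI : forall i j, i \in V -> j \in V -> i != j -> #|r i :&: r j| <= l.

Local Open Scope ring_scope.

Definition point (T : {set 'I_n}) : d.-tuple bool := [tuple t \in union_set r T | t < d].

Lemma l1norm_ge0 (v : 'rV[R]_d) : 0 <= l1norm v.
Proof. by apply: sumr_ge0 => i _; apply: normr_ge0. Qed.

Lemma l1norm_sub (u v w : 'rV[R]_d) : l1norm (u - v) <= l1norm (u - w) + l1norm (v - w).
Proof.
rewrite /l1norm -big_split /=; apply: ler_sum => i _; rewrite !mxE.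
by rewrite [`|v ord0 i - _|]distrC; apply: ler_distD.
Qed.

Lemma l1norm_point (T S : {set 'I_n}) :
  l1norm (cube_point R (point T) - cube_point R (point S)) =
  (#|union_set r T :\: union_set r S| + #|union_set r S :\: union_set r T|)%:R.
Proof.
rewrite -!sum1_card [X in (X + _)%N]big_mkcond [X in (_ + X)%N]big_mkcond /=.
rewrite -big_split /= natr_sum; apply: eq_bigr => t _.
rewrite !mxE !tnth_mktuple !inE.
by case: (t \in _); case: (t \in _) => /=; rewrite ?subrr ?normr0 ?subr0 ?sub0r ?normrN ?normr1.
Qed.

Variables (z y k : nat) (E : seq {set 'I_n}).
Hypothesis y_lt_z : (y < z)%N.
Hypothesis k_gt0 : (0 < k)%N.
Hypothesis E_card : forall T, T \in E -> #|T| = z.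
Hypothesis E_sub : forall T, T \in E -> T \subset V.

Lemma clustering_complete : johnson_complete y k E ->
  exists (c : 'I_k -> 'rV[R]_d) (sigma : d.-tuple bool -> 'I_k),
    kmedian_cost (map point E) c sigma <= (size E * ((z - y) * p))%:R.
Proof.
case=> S [hS hcov].
pose c i := cube_point R (point (S i)).
(* An assignment sees points, not sets, so the center is picked by distance; the default is never
   reached on points of [E]. *)
pose sigma a := odflt (Ordinal k_gt0)
  [pick i | l1norm (cube_point R a - c i) <= ((z - y) * p)%:R].
exists c, sigma; rewrite /kmedian_cost big_map natrM mulr_natl -sumr_const_seq.
rewrite !big_seq; apply: ler_sum => T hT.
rewrite /sigma; case: pickP => [i //|h].
have /existsP[i hi] := hcov T hT; have /negP[] := h i.
rewrite /c l1norm_point ler_nat -(E_card hT) -(hS i).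
by apply: (card_union_setD_le card_r) hi; apply: E_sub.
Qed.

Section Soundness.

Hypothesis y_gt0 : (0 < y)%N.
Hypothesis E_uniq : uniq E.
Hypothesis E_gt0 : (0 < size E)%N.

Variables (c : 'I_k -> 'rV[R]_d) (sigma : d.-tuple bool -> 'I_k).

Let u := (p - 2 * z * l)%N.
Let D (T : {set 'I_n}) : R := l1norm (cube_point R (point T) - c (sigma (point T))).
(** Used at [m = y] and [m = y.-1], that is with the thresholds [(z - y) * u] and
    [(z - y).+1 * u]. *)
Let near (m : nat) (T : {set 'I_n}) : bool := D T < ((z - m) * u)%:R.
Let cluster m i : {set {set 'I_n}} := [set T in E | near m T & sigma (point T) == i].
Let exceptional := (2 ^ z * z * n ^ (z - y - 1))%N.

(** If the sets shared at most [m] elements, both differences would have at least [z - m], and the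
    points would be at distance at least [2 * (z - m) * u], too far for a common center. *)
Lemma cluster_meet m i T T' : (m <= z)%N -> T \in cluster m i -> T' \in cluster m i ->
  (m < #|T :&: T'|)%N.
Proof.
move=> hm; rewrite !inE => /and3P[hT nT /eqP sT] /and3P[hT' nT' /eqP sT'].
rewrite ltnNge; apply/negP => hTT.
have := l1norm_sub (cube_point R (point T)) (cube_point R (point T')) (c i).
rewrite leNgt => /negP[].
apply: lt_le_trans (_ : ((z - m) * u)%:R + ((z - m) * u)%:R <= _).
  by apply: ltrD; [move: nT; rewrite /near /D sT | move: nT'; rewrite /near /D sT'].
rewrite l1norm_point -natrD ler_nat.
have zT := E_card hT; have zT' := E_card hT'.
apply: leq_add.
  apply: leq_trans (card_union_setD_ge (z := z) card_r card_rI (E_sub hT) (E_sub hT') _ _);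
    rewrite ?zT ?zT' //.
  by rewrite /u leq_mul2r; apply/orP; right; rewrite cardsD zT leq_sub2l.
apply: leq_trans (card_union_setD_ge (z := z) card_r card_rI (E_sub hT') (E_sub hT) _ _);
  rewrite ?zT ?zT' //.
by rewrite /u leq_mul2r; apply/orP; right; rewrite cardsD setIC zT' leq_sub2l.
Qed.

Lemma cluster_card m i T : T \in cluster m i -> #|T| = z.
Proof. by rewrite !inE => /and3P[/E_card]. Qed.

Lemma count_by_cluster (P : pred {set 'I_n}) :
  count P E = (\sum_(i < k) #|[set T in E | P T & sigma (point T) == i]|)%N.
Proof.
have cardE i : #|[set T in E | P T & sigma (point T) == i]| =
    count (fun T => P T && (sigma (point T) == i)) E.
  rewrite cardE -size_filter; apply: perm_size; apply: uniq_perm.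
  - exact: enum_uniq.
  - exact: filter_uniq.
  - by move=> T; rewrite mem_enum mem_filter inE andbC.
rewrite (eq_bigr _ (fun i _ => cardE i)) -sum1_count big_mkcond /=.
rewrite (eq_bigr (fun i => \sum_(T <- E) (P T && (sigma (point T) == i)))%N); last first.
  move=> i _; rewrite -sum1_count big_mkcond /=.
  by apply: eq_bigr => T _; case: (_ && _).
rewrite exchange_big /=; apply: eq_bigr => T _.
rewrite (bigD1 (sigma (point T))) //= eqxx andbT big1 => [|i /negPf hi].
  by case: (P T).
by rewrite eq_sym hi andbF.
Qed.

Lemma count_near_y : (count (near y) E <= k * exceptional)%N.
Proof.
rewrite count_by_cluster; apply: (@leq_trans (\sum_(i < k) exceptional)%N); last first.
  by rewrite sum_nat_const card_ord.
apply: leq_sum => i _.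
apply: leq_trans (card_intersecting (z := z) (m := y.+1) _ _) _.
- exact: cluster_card.
- by move=> T T'; apply: cluster_meet; apply: ltnW.
(* The bound is weakened by a factor [z] to share [exceptional] with the other threshold. *)
- rewrite /exceptional -subnDA addn1 leq_mul2r leq_pmulr ?orbT //.
  by apply: leq_trans y_lt_z.
Qed.

(** [S i] is a common [y]-subset of the i-th cluster when one exists, so that near sets left
    uncovered lie only in clusters without one, which are small. *)
Lemma count_near_pred : exists S : 'I_k -> {set 'I_n}, (forall i, #|S i| = y) /\
  (count (near y.-1) E <= count (covers S) E + k * exceptional)%N.
Proof.
have [S0 hS0] : exists S0 : {set 'I_n}, #|S0| = y.
  have [T hT] : exists T, T \in E by case: (E) E_gt0 => // T E' _; exists T; rewrite mem_head.
  have [|S0 _ hS0] := @subset_of_card _ T y; last by exists S0.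
  by rewrite E_card // ltnW.
pose kernel i (S : {set 'I_n}) := (#|S| == y) && [forall T in cluster y.-1 i, S \subset T].
pose S i := odflt S0 [pick S | kernel i S].
have hS i : #|S i| = y.
  by rewrite /S; case: pickP => [S1 /andP[/eqP ->]|].
exists S; split=> //.
have -> : count (near y.-1) E = (count (predI (near y.-1) (covers S)) E +
    count (predI (near y.-1) (predC (covers S))) E)%N.
  by elim: (E) => //= T E' ->; case: (near _ T); case: (covers S T); rewrite /= ?addnS ?addnA.
apply: leq_add; first by apply: sub_count => T /andP[].
rewrite count_by_cluster; apply: (@leq_trans (\sum_(i < k) exceptional)%N); last first.
  by rewrite sum_nat_const card_ord.
apply: leq_sum => i _.
case: (pickP (kernel i)) => [S1 hS1|hno].
  have /andP[_ /forall_inP hk] : kernel i (S i) by rewrite /S; case: pickP => // /(_ S1); rewrite hS1.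
  rewrite (_ : [set _ in _ | _] = set0) ?cards0 //.
  apply/setP => T; rewrite !inE; apply/negP => /and3P[hT /andP[h1 h2] h3].
  case/negP: h2; apply/existsP; exists i; apply: hk.
  by rewrite inE hT h1.
apply: leq_trans (_ : #|cluster y.-1 i| <= _)%N.
  apply/subset_leq_card/subsetP => T; rewrite !inE => /and3P[-> /andP[-> _] ->] //.
apply: card_intersecting_no_kernel => //.
- exact: cluster_card.
- move=> T T' hT hT'; rewrite -(prednK y_gt0); apply: cluster_meet hT hT'.
  by apply: leq_trans (ltnW y_lt_z); apply: leq_pred.
- move=> S1 hS1; have := hno S1; rewrite /kernel hS1 eqxx /= => /negbT.
  by rewrite negb_forall_in => /exists_inP[T h1 h2]; exists T.
Qed.

Lemma clustering_sound (alpha : R) : johnson_sound alpha y k E ->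
  (size E * ((z - y).+1 * u))%:R <= kmedian_cost (map point E) c sigma +
    u%:R * (alpha * (size E)%:R + ((z - y).+1 * (k * exceptional))%:R).
Proof.
move=> hsound; have [S [hS h1]] := count_near_pred.
have h2 := hsound S hS; have h3 := count_near_y.
(* Between the two thresholds a point misses at most [u] of the full price; below the lower one the
   two terms refund the whole price. *)
have pw T : ((z - y).+1 * u)%:R <= D T + (near y.-1 T * u + near y T * ((z - y) * u))%:R.
  have ez : (z - y.-1 = (z - y).+1)%N by lia.
  have hD : 0 <= D T by apply: l1norm_ge0.
  rewrite /near ez; case: (ltP (D T) ((z - y) * u)%:R) => h.
    have -> : D T < ((z - y).+1 * u)%:R.
      by apply: lt_le_trans h _; rewrite ler_nat leq_mul2r leqnSn orbT.
    by rewrite !mul1n -mulSn ler_wpDl.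
  case: (ltP (D T) ((z - y).+1 * u)%:R) => h' /=; last by rewrite mul0n mul0n addn0 addr0.
  by rewrite mul1n mul0n addn0 mulSn addnC natrD lerD2r.
have : (size E * ((z - y).+1 * u))%:R <= kmedian_cost (map point E) c sigma +
    (count (near y.-1) E * u + count (near y) E * ((z - y) * u))%:R.
  rewrite natrM mulr_natl -sumr_const_seq /kmedian_cost big_map.
  rewrite -!sum1_count !(big_mkcond (near _)) /= !big_distrl -big_split /= natr_sum.
  rewrite -big_split /=; apply: ler_sum => T _; apply: le_trans (pw T) _.
  by rewrite /D; case: (near y.-1 T); case: (near y T).
move/le_trans; apply; rewrite lerD2l.
apply: (@le_trans _ _ (((count (covers S) E)%:R + ((z - y).+1 * (k * exceptional))%:R) * u%:R)).
  rewrite -natrD -natrM ler_nat mulnA -mulnDl leq_mul2r; apply/orP; right.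
  rewrite mulSn addnA leq_add // mulnC leq_mul2l h3 orbT //.
by rewrite mulrC ler_wpM2l // lerD2r.
Qed.

End Soundness.

(** Private parts are then nonempty, so equal points force inclusion, hence equality of sets of the
    same size. The output is thus a point-set of size |E|. *)
Lemma point_inj : (2 * z * l < p)%N -> {in E &, injective point}.
Proof.
move=> hp T T' hT hT' e; apply/eqP; rewrite eqEcard (E_card hT) (E_card hT') leqnn andbT.
rewrite -setD_eq0 -cards_eq0 -leqn0 -(@leq_pmul2r (p - 2 * z * l)) ?subn_gt0 // mul0n.
apply: leq_trans (card_union_setD_ge (z := z) card_r card_rI (E_sub hT) (E_sub hT') _ _) _;
  rewrite ?(E_card hT) ?(E_card hT') //.
rewrite leqn0 cards_eq0 setD_eq0; apply/subsetP => t.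
have := congr1 (fun a => tnth a t) e; rewrite !tnth_mktuple => ->; exact.
Qed.

End Cost.

(** * The reduction on an instance *)

Definition row_of (n : nat) (T : {set 'I_n}) : seq bool := [seq i \in T | i <- enum 'I_n].

Lemma size_row_of n (T : {set 'I_n}) : size (row_of T) = n.
Proof. by rewrite size_map size_enum_ord. Qed.

Lemma nth_row_of n (T : {set 'I_n}) (i : 'I_n) : nth false (row_of T) i = (i \in T).
Proof. by rewrite (nth_map i) ?size_enum_ord // nth_ord_enum. Qed.

Definition used (n : nat) (E : seq {set 'I_n}) : seq bool :=
  foldl (orv true) (nseq n false) (map (@row_of n) E).

Lemma nth_used n (E : seq {set 'I_n}) (i : 'I_n) :
  nth false (used E) i = has (fun T : {set 'I_n} => i \in T) E.
Proof.
have main : forall u : seq bool, size u = n ->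
    nth false (foldl (orv true) u (map (@row_of n) E)) i =
    nth false u i || has (fun T : {set 'I_n} => i \in T) E.
  elim: E => [|T E' IH] u hsz /=; first by rewrite orbF.
  by rewrite IH ?size_orv // nth_orv ?hsz // nth_row_of orbA.
by rewrite /used main ?size_nseq // nth_nseq if_same.
Qed.

Lemma size_used n (E : seq {set 'I_n}) : size (used E) = n.
Proof.
have main (u : seq bool) : size (foldl (orv true) u (map (@row_of n) E)) = size u.
  by elim: E u => //= T E' IH u; rewrite IH size_orv.
by rewrite /used main size_nseq.
Qed.

Lemma count_used n z (E : seq {set 'I_n}) : (forall T, T \in E -> #|T| = z) ->
  count id (used E) <= size E * z.
Proof.
move=> hE.
have -> : count id (used E) = \sum_(i < n) nth false (used E) i.
  rewrite -sum1_count (big_nth false) size_used big_mkord big_mkcond /=.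
  by apply: eq_bigr => i _; case: nth.
apply: (@leq_trans (\sum_(i < n) \sum_(T <- E) (i \in T))).
  apply: leq_sum => i _; rewrite nth_used; case: hasP => // -[T hT hi].
  by rewrite (big_rem T) //= hi.
rewrite exchange_big /= -sum1_size big_distrl /= !big_seq; apply: leq_sum => T hT.
rewrite mul1n -(hE T hT) -sum1_card [leqRHS]big_mkcond /=; apply: leq_sum => i _.
by case: (i \in T).
Qed.

Section Instance.

Variables (s z y n k : nat) (E : seq {set 'I_n}).
Hypothesis E_wf : johnson_wf z k E.
Hypothesis z_gt0 : 0 < z.
Hypothesis E_gt1 : 1 < size E.
Hypothesis s_gt : 2 * z < s.

Definition logE : nat := (size (iter (size E) incr [::])).-1.
(** With Q = 2^(s+z+1) and l = [logE], Q^(l+1) / 2^(l s) is at least 2^(l+1) 2^z, which exceeds |E|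
    z and so the number of used elements. *)
Definition block_len : nat := s * 2 ^ (s + z.+1).
Definition code_len : nat := logE * block_len.
Definition code : seq (seq bool) := greedy logE (logE * s) (all_words code_len) [::].
Definition word_of (i : 'I_n) : {set 'I_code_len} :=
  word_set code_len (nth [::] code (rank (used E) i)).
Definition used_set : {set 'I_n} := [set i : 'I_n | nth false (used E) i].

Lemma logE_bounds : 2 ^ logE <= size E < 2 ^ logE.+1.
Proof.
have [h1 h2] := iter_incr (ltnW E_gt1); rewrite /logE.
by case: (iter _ _ _) h1 h2.
Qed.

Lemma logE_gt0 : 0 < logE.
Proof. by have /andP[_] := logE_bounds; rewrite lt0n; apply: contraTneq => ->; rewrite -leqNgt. Qed.

Lemma s_gt1 : 1 < s. Proof. by clear -s_gt z_gt0; lia. Qed.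

Lemma code_len_gt0 : 0 < code_len.
Proof. by rewrite /code_len /block_len !muln_gt0 logE_gt0 expn_gt0 (ltnW s_gt1). Qed.

Lemma code_size : count id (used E) <= size code.
Proof.
have [_ _ _ hE] := E_wf; apply: leq_trans (count_used hE) _.
have := @size_greedy_code logE s (2 ^ (s + z.+1)).
rewrite expn_gt0 logE_gt0 s_gt1 -mulnA -/block_len -/code_len -/code => /(_ isT isT isT) h.
have hp : 0 < 2 ^ (logE * s) by rewrite expn_gt0.
rewrite -(leq_pmul2r hp); apply: leq_trans h; rewrite -expnM mulnC.
have /andP[_ h2] := logE_bounds.
apply: (@leq_trans (2 ^ (logE * s) * (2 ^ logE.+1 * 2 ^ z))).
  by rewrite leq_mul2l leq_mul ?orbT // ltnW // ltn_expl.
by rewrite -!expnD leq_exp2l //; clear; nia.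
Qed.

Lemma code_okE : code_ok logE (logE * s) code_len code.
Proof.
apply: code_ok_greedy; last by split => // i j; rewrite ltn0 andbF.
by apply/allP => v; rewrite mem_all_words.
Qed.

Lemma rank_code i : i \in used_set -> rank (used E) i < size code.
Proof. by rewrite inE => /rank_lt_count h; apply: leq_trans h code_size. Qed.

Lemma word_of_size i : i \in used_set -> size (nth [::] code (rank (used E) i)) = code_len.
Proof.
by move=> /rank_code h; case: code_okE => h1 _ _; apply/eqP/(all_nthP [::] h1).
Qed.

Lemma card_word_of i : i \in used_set -> #|word_of i| = logE * s.
Proof.
move=> hi; rewrite card_word_set ?word_of_size //.
by case: code_okE => _ h2 _; apply/eqP/(all_nthP [::] h2)/rank_code.
Qed.

Lemma card_word_ofI i j : i \in used_set -> j \in used_set -> i != j ->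
  #|word_of i :&: word_of j| <= logE.
Proof.
case: code_okE => _ _ h3.
wlog lt_ij : i j / i < j.
  move=> hw hi hj hij; have [lij|lji|/val_inj e] := ltngtP i j.
  - exact: hw.
  - by rewrite setIC; apply: hw => //; rewrite eq_sym.
  - by rewrite e eqxx in hij.
move=> hi hj _; rewrite card_word_setI ?word_of_size //; apply: h3.
by rewrite rank_code // andbT rank_lt //; rewrite inE in hi.
Qed.

Lemma sub_used_set T : T \in E -> T \subset used_set.
Proof.
by move=> hT; apply/subsetP => i hi; rewrite inE nth_used; apply/hasP; exists T.
Qed.

Lemma row_or_point T : T \in E ->
  row_or (used E) (row_of T) code (nseq code_len false) = point word_of T.
Proof.
move=> hT; apply: (@eq_from_nth _ false) => [|t].
  by rewrite size_row_or size_nseq size_tuple.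
rewrite size_row_or size_nseq => ht.
rewrite nth_row_or ?size_row_of ?size_used ?size_nseq // nth_nseq ht /=.
have -> : nth false (point word_of T) t = tnth (point word_of T) (Ordinal ht).
  by rewrite (tnth_nth false).
rewrite tnth_mktuple.
apply/hasP/union_setP => [[i]|[i hi hti]].
  rewrite mem_iota add0n => /= hi /and3P[h1 h2 h3]; exists (Ordinal hi).
    by rewrite -nth_row_of.
  by rewrite inE.
exists (val i); first by rewrite mem_iota add0n /=.
have := subsetP (sub_used_set hT) i hi; rewrite inE => -> /=.
by rewrite nth_row_of hi /=; rewrite inE in hti.
Qed.

Lemma run_reduction_instance : exists2 st,
  st 0 = kmedian_encode k (map (point word_of) E) &
  run (reduction s block_len) (input_store (johnson_encode k E)) st
    (reduction_time s block_len (size (johnson_encode k E))).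
Proof.
have [_ hE0 _ hE] := E_wf.
have hn : 0 < n.
  case: (E) hE hE0 => // T E' /(_ T (mem_head _ _)) hT _.
  by have := max_card (mem T); rewrite hT card_ord => h; apply: leq_trans h.
have hrows : all (fun r => size r == n) (map (@row_of n) E).
  by apply/allP => r /mapP[T _ ->]; rewrite size_row_of.
have := @run_reduction s block_len n k (map (@row_of n) E) hn.
rewrite size_map -/logE -/code_len -/code -/(used E) => /(_ hE0 code_len_gt0 hrows code_size).
case=> st hst hrun; exists st => //.
rewrite hst /kmedian_encode; congr (_ ++ (_ ++ flatten _)).
by rewrite -!map_comp; apply/eq_in_map => T hT /=; rewrite row_or_point.
Qed.

End Instance.

(** * Finitely many instances *)

(** A leaf knows the bits read so far as a constant, so answers can be built into it; its Boolean
    says that the input ended early. *)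
Fixpoint table (leaf : seq bool -> bool -> cmd) (m : nat) (u : seq bool) : cmd :=
  if m is m'.+1 then
    If nonempty 0
      (If is_one 0 (Seq (Pop 0) (table leaf m' (rcons u true)))
                   (Seq (Pop 0) (table leaf m' (rcons u false))))
      (leaf u true)
  else leaf u false.

Lemma run_table leaf m u x s T :
  run (leaf (u ++ take m x) (size x < m)) (input_store (drop m x)) s T ->
  run (table leaf m u) (input_store x) s (T + 5 * m).
Proof.
elim: m u x => [|m IH] u x /=.
  by rewrite take0 drop0 cats0 ltn0; move/run_conv; apply=> //; rewrite addn0.
case: x => [|b x] /=.
  by rewrite cats0 => h; apply: run_conv; [apply: (run_if (T := T)); exact: h | by [] | lia].
rewrite ltnS -cat_rcons => /IH h.
have hpop : run (Pop 0) (input_store (b :: x)) (input_store x) 1.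
  apply: run_conv; [exact: run_pop | | exact: leqnn].
    by apply: funext => -[|i]; rewrite /upd.
apply: (run_conv (T1 := ((1 + (T + 5 * m)).+2).+2)); last by lia.
  apply: run_if => /=; apply: run_if => /=.
  by case: b h hpop => h hpop; apply: run_seq hpop h.
by [].
Qed.

Lemma unary_inj n n' r r' : unary n ++ r = unary n' ++ r' -> n = n' /\ r = r'.
Proof.
elim: n n' => [|n IH] [|n'] //=; first by case.
by case=> /IH[-> ->].
Qed.

Lemma flatten_rows_inj n (s s' : seq (seq bool)) : 0 < n ->
  all (fun r => size r == n) s -> all (fun r => size r == n) s' ->
  flatten s = flatten s' -> s = s'.
Proof.
move=> hn; elim: s s' => [|r s IH] [|r' s'] //=.
- by move=> _ /andP[/eqP hr _]; case: r' hr => // e; rewrite -e in hn.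
- by move=> /andP[/eqP hr _] _; case: r hr => // e; rewrite -e in hn.
move=> /andP[/eqP hr hs] /andP[/eqP hr' hs'] /eqP.
by rewrite eqseq_cat ?hr ?hr' // => /andP[/eqP -> /eqP /IH ->].
Qed.

Section Encoding.

Variables (z : nat).
Hypothesis z_gt0 : 0 < z.

Lemma johnson_wf_gt0 n k (E : seq {set 'I_n}) : johnson_wf z k E -> 0 < n.
Proof.
case=> _ + _; case: E => // T E _ /(_ T (mem_head _ _)) hT.
by have := max_card (mem T); rewrite hT card_ord => h; apply: leq_trans h.
Qed.

Lemma row_of_inj n : injective (@row_of n).
Proof. by move=> T T' e; apply/setP => i; rewrite -!nth_row_of e. Qed.

(** The types of [E] and [E'] depend on [n] and [n'], so injectivity is stated as transport of a
    predicate. *)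
Lemma johnson_encode_inj n k (E : seq {set 'I_n}) n' k' (E' : seq {set 'I_n'})
    (P : forall m, nat -> seq {set 'I_m} -> Prop) :
  johnson_wf z k E -> johnson_wf z k' E' -> johnson_encode k E = johnson_encode k' E' ->
  P n' k' E' -> P n k E.
Proof.
move=> w w' /unary_inj[en]; case: _ / en in E' w' *.
move=> /unary_inj[<-] /(flatten_rows_inj (johnson_wf_gt0 w)) h; suff -> : E = E' by [].
by apply: (inj_map (@row_of_inj n)); apply: h; apply/allP => r /mapP[T _ ->];
  rewrite [X in X == _]size_row_of.
Qed.

End Encoding.

Lemma johnson_wf_size_le z n k (E : seq {set 'I_n}) : johnson_wf z k E -> size E <= 2 ^ n.
Proof.
case=> _ _ /card_uniqP <- _; rewrite -[n in 2 ^ n]card_ord -cardsT -card_powerset.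
by apply: leq_trans (max_card _) _; rewrite powersetT cardsT.
Qed.

Local Open Scope ring_scope.

(* With at least as many centers as sets, every set gets its own center. *)
Lemma johnson_sound_k_lt (R : realType) (alpha : R) z y n k (E : seq {set 'I_n}) :
  (y < z)%N -> alpha < 1 -> johnson_wf z k E -> johnson_sound alpha y k E ->
  (k < size E)%N.
Proof.
move=> hyz ha [hk hE0 _ hE] hs; rewrite ltnNge; apply/negP => hle.
have hsub (T : {set 'I_n}) : T \in E -> exists2 S : {set 'I_n}, S \subset T & #|S| = y.
  by move=> hT; apply: subset_of_card; rewrite hE // ltnW.
have [T0 hT0] : exists T, T \in E by case: (E) hE0 => // T E' _; exists T; rewrite mem_head.
have hS (i : 'I_k) : exists S : {set 'I_n}, #|S| = y /\
    ((i < size E)%N -> S \subset nth set0 E i).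
  case: (ltnP i (size E)) => hi.
    by have [S h1 h2] := hsub _ (mem_nth set0 hi); exists S.
  by have [S h1 h2] := hsub _ hT0; exists S.
have [S hS'] := choice hS.
have := hs S (fun i => (hS' i).1).
have -> : count (covers S) E = size E.
  apply/eqP; rewrite -all_count; apply/allP => T hT; apply/existsP.
  have hi : (index T E < k)%N by apply: leq_trans hle; rewrite index_mem.
  exists (Ordinal hi); have := (hS' (Ordinal hi)).2; rewrite /= index_mem => /(_ hT).
  by rewrite nth_index.
rewrite leNgt => /negP[]; rewrite gtr_pMl // ltr0n //.
Qed.

(** * Constant instances *)

(** Two points on a line, each its own center, cost nothing. *)
Lemma kmedian_yes_instance (R : realType) (rho gamma D : R) : 0 <= rho -> 1 <= D * ln 2 ->
  exists x, yes_instance (kmedian_gap rho gamma D) x.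
Proof.
move=> hrho hD; pose P : seq (1.-tuple bool) := [:: [tuple false]; [tuple true]].
exists (kmedian_encode 2 P), 1%N, 2%N, P; split=> //.
pose c (i : 'I_2) : 'rV[R]_1 := \row_j (nat_of_ord i)%:R.
exists c, (fun a : 1.-tuple bool => inord (nat_of_bool (thead a))).
rewrite /kmedian_cost !big_cons big_nil /= /l1norm !big_ord1 !mxE.
have -> : tnth [tuple false] (ord0 : 'I_1) = false by [].
have -> : tnth [tuple true] (ord0 : 'I_1) = true by [].
rewrite !inordK // !subrr normr0 !addr0.
by rewrite !mulr_ge0 // ln_ge0 // ler1n.
Qed.

(** Two antipodal points of the cube share a single center, so they cost at least their distance
    [d]. *)
Lemma kmedian_no_instance (R : realType) (rho gamma D : R) d : (0 < d)%N ->
  d%:R <= D * ln 2 -> gamma * (rho * 2 * ln 2) <= d%:R ->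
  exists x, no_instance (kmedian_gap rho gamma D) x.
Proof.
move=> hd hD hg; pose a b : d.-tuple bool := [tuple b | _ < d].
exists (kmedian_encode 1 [:: a false; a true]), d, 1%N, [:: a false; a true].
split=> //=.
  split=> //=; rewrite inE andbT; apply/eqP => /(congr1 (fun t => tnth t (Ordinal hd))).
  by rewrite !tnth_mktuple.
move=> c sigma; apply: le_trans hg _.
rewrite /kmedian_cost !big_cons big_nil addr0 (ord1 (sigma (a false))) (ord1 (sigma (a true))).
apply: le_trans (l1norm_sub _ _ _).
rewrite /l1norm (eq_bigr (fun=> 1)); first by rewrite sumr_const card_ord.
by move=> i _; rewrite !mxE !tnth_mktuple sub0r normrN normr1.
Qed.

(** * The gap *)

(** Here a = z - y, e = |E|, L = ln |E|, and x is the weighted bound on exceptional sets. The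
    hypotheses with [eps] give one third of it each to overlaps, rounding of the logarithm and
    exceptions. *)
Lemma gap_bound (R : realType) (alpha eps cost L : R) (a z s l e x : nat) :
  0 <= alpha -> alpha < 1 -> 0 < eps -> (0 < a)%N -> (a < z)%N -> (2 * z <= s)%N ->
  (z ^ 2)%:R * 6 <= s%:R * eps -> z%:R * 3 <= l%:R * eps ->
  x%:R * 3 <= eps * e%:R -> 0 <= L -> L <= l.+1%:R * ln 2 -> 0 <= cost ->
  (e * (a.+1 * (l * s - 2 * z * l)))%:R <=
    cost + (l * s - 2 * z * l)%:R * (alpha * e%:R + x%:R) ->
  (1 + (1 - alpha) / a%:R - eps) * ((a * s)%:R / ln 2 * e%:R * L) <= cost.
Proof.
move=> a0 a1 e0 ha haz hsz hs hl hx L0 L1 c0 h.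
have ln2 : 0 < ln 2 :> R by rewrite ln_gt0 // ltr1n.
have ha' : 0 < a%:R :> R by rewrite ltr0n.
set g := 1 + _ - _.
(* For large [eps] the factor may be negative, and [cost >= 0] suffices; otherwise [L] can be
   replaced by its upper bound. *)
have [g0|g0] := leP g 0.
  apply: le_trans c0; apply: mulr_le0_ge0 => //.
  by rewrite !mulr_ge0 // invr_ge0 ltW.
have -> : g * ((a * s)%:R / ln 2 * e%:R * L) = (g * a%:R) * s%:R * e%:R * (L / ln 2).
  by rewrite natrM; ring.
have hg : g * a%:R = a%:R + (1 - alpha) - a%:R * eps.
  rewrite /g; field; exact: lt0r_neq0.
have hL : L / ln 2 <= l.+1%:R by rewrite ler_pdivrMr.
apply: le_trans (_ : (g * a%:R) * s%:R * e%:R * l.+1%:R <= _).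
  by apply: ler_wpM2l hL; rewrite !mulr_ge0 // ltW.
rewrite hg; move: h; rewrite [(2 * z * l)%N]mulnC -mulnBr !natrM natrB //.
rewrite -[a.+1%:R]natr1 -[l.+1%:R]natr1 [(2 * z)%:R]natrM.
have ha1 : 1 <= a%:R :> R by rewrite ler1n.
have haz' : a%:R + 1 <= z%:R :> R by rewrite natr1 ler_nat.
have hsz' : 2 * z%:R <= s%:R :> R by rewrite -natrM ler_nat.
move: hs hl hx; rewrite natrX expr2.
have : 0 <= e%:R :> R by []. have : 0 <= l%:R :> R by [].
move: (a%:R : R) (z%:R : R) (s%:R : R) (l%:R : R) (e%:R : R) (x%:R : R) ha1 haz' hsz'.
clear -a0 a1 e0 => A Z S l e x A1 AZ SZ l0 e0' hs hl hx h.
pose W := A + 1 - alpha.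
have W0 : 0 <= W by rewrite /W; lra.
have WZ : W <= Z by rewrite /W; lra.
have S0 : 0 <= S by lra.
have Z0 : 0 <= Z by lra.
have c1 : l * (S - 2 * Z) * e * (W - eps / 3) <= cost.
  have : l * (S - 2 * Z) * x <= l * (S - 2 * Z) * (eps / 3 * e).
    by apply: ler_wpM2l; [apply: mulr_ge0 => //; lra | lra].
  by move: h; rewrite /W; nra.
apply: le_trans c1; rewrite (_ : A + (1 - alpha) - A * eps = W - A * eps); last by rewrite /W; ring.
suff : (W - A * eps) * S * (l + 1) <= l * (S - 2 * Z) * (W - eps / 3).
  by move=> hh; have := ler_wpM2r e0' hh; lra.
(* [b1] bounds the rounding loss and [b2] the overlap loss, while exceptions already cost [eps / 3];
   [b3] pays for all three because [A >= 1]. *)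
have b1 : S * W <= S * (l * eps / 3).
  by apply: ler_wpM2l => //; lra.
have b2 : 2 * Z * W * l <= S * eps / 3 * l.
  by apply: ler_wpM2r => //; have : Z * W <= Z * Z by [exact: ler_wpM2l]; lra.
have b3 : eps * (S * (l + 1)) <= A * eps * (S * (l + 1)).
  apply: ler_wpM2r; first by rewrite mulr_ge0 //; lra.
  by rewrite ler_peMl // ltW.
have b4 : 0 <= eps * S by rewrite mulr_ge0 // ltW.
have b5 : 0 <= l * Z * eps by rewrite !mulr_ge0 // ltW.
lra.
Qed.

(** * Correctness of the reduction when the bound on |E| applies *)

Section LargeInstance.

Variables (R : realType) (alpha eps : R) (z y K n k : nat) (E : seq {set 'I_n}).

(** At least [K] for the overlap error, and above [2 * z] so that private parts are nonempty. *)
Definition weight_factor : nat := (K + 2 * z + 1)%N.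
(** The summands make the exceptional fraction small, force [K <= logE E], and give |E| > 1. *)
Definition threshold : nat := (K + 2 ^ K.+1 + 2)%N.

Local Notation s := weight_factor.
Local Notation l := (logE E).
Local Notation d := (code_len s z E).
Local Notation P := (map (point (@word_of s z n E)) E).

Hypothesis y_gt0 : (0 < y)%N.
Hypothesis y_lt_z : (y < z)%N.
Hypothesis alpha_ge0 : 0 <= alpha.
Hypothesis alpha_lt1 : alpha < 1.
Hypothesis eps_gt0 : 0 < eps.
Hypothesis K_large : (6 * z ^ 2 * 2 ^ z)%:R <= K%:R * eps.
Hypothesis E_wf : johnson_wf z k E.
Hypothesis E_large : (threshold * (k * n ^ (z - y - 1)) <= size E)%N.

Let z_gt0 : (0 < z)%N := leq_ltn_trans (leq0n y) y_lt_z.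

Lemma threshold_le : (threshold <= size E)%N.
Proof.
have [hk _ _ _] := E_wf; apply: leq_trans E_large.
by rewrite leq_pmulr // muln_gt0 hk expn_gt0 (johnson_wf_gt0 z_gt0 E_wf).
Qed.

Lemma size_gt1 : (1 < size E)%N.
Proof. by apply: leq_trans threshold_le; rewrite /threshold addn2. Qed.

Lemma s_gt_2z : (2 * z < s)%N.
Proof. by rewrite /weight_factor addn1 ltnS leq_addl. Qed.

Lemma K_le_log : (K <= l)%N.
Proof.
have /andP[_ h] := logE_bounds size_gt1.
have : (2 ^ K.+1 < 2 ^ l.+1)%N.
  apply: leq_ltn_trans h; apply: leq_trans threshold_le.
  by rewrite /threshold; lia.
by rewrite ltn_exp2l // ltnS => /ltnW.
Qed.

Lemma ln_size_ge : l%:R * ln 2 <= ln (size E)%:R :> R.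
Proof.
have /andP[h _] := logE_bounds size_gt1.
rewrite mulr_natl -lnXn // -natrX ler_ln ?posrE ?ltr0n ?expn_gt0 ?ler_nat //.
exact: ltnW size_gt1.
Qed.

Lemma ln_size_le : ln (size E)%:R <= l.+1%:R * ln 2 :> R.
Proof.
have /andP[_ h] := logE_bounds size_gt1.
rewrite mulr_natl -lnXn // -natrX ler_ln ?posrE ?ltr0n ?expn_gt0 ?ler_nat //.
  exact: ltnW.
exact: ltnW size_gt1.
Qed.

Lemma ln2_gt0 : 0 < ln 2 :> R.
Proof. by rewrite ln_gt0 // ltr1n. Qed.

Let wf_card := card_word_of E_wf z_gt0 size_gt1 s_gt_2z.
Let wf_cardI := card_word_ofI E_wf z_gt0 size_gt1 s_gt_2z.

Lemma E_cardz T : T \in E -> #|T| = z.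
Proof. by have [_ _ _] := E_wf; apply. Qed.

Lemma output_wf : kmedian_wf k P.
Proof.
have [hk _ hu _] := E_wf; split; rewrite ?size_map ?size_gt1 //.
rewrite map_inj_in_uniq //; apply: (point_inj wf_card wf_cardI E_cardz).
  exact: sub_used_set.
by rewrite mulnC ltn_pmul2l ?s_gt_2z // (logE_gt0 size_gt1).
Qed.

Lemma output_dim (D : R) : (block_len s z)%:R <= D * ln 2 -> d%:R <= D * ln (size P)%:R.
Proof.
move=> D_large; rewrite size_map /code_len natrM.
have hln := ln_size_ge; have hD : 0 <= D.
  by rewrite -(pmulr_lge0 _ ln2_gt0); apply: le_trans D_large.
apply: le_trans (ler_wpM2l hD hln); rewrite mulrCA.
by apply: ler_wpM2l.
Qed.

(** In the complete case a point pays at most [(z - y) * (l * s)], and [l] is at most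
    [ln |E| / ln 2]. *)
Let rho : R := ((z - y) * s)%:R / ln 2.

Lemma output_complete : johnson_complete y k E ->
  exists (c : 'I_k -> 'rV[R]_d) (sigma : d.-tuple bool -> 'I_k),
    kmedian_cost P c sigma <= rho * (size P)%:R * ln (size P)%:R.
Proof.
have [hk _ _ _] := E_wf => hc.
have [c [sigma h]] := clustering_complete R wf_card hk E_cardz (@sub_used_set _ E) hc.
exists c, sigma; apply: le_trans h _; rewrite size_map mulrAC [leRHS]mulrC natrM.
apply: ler_wpM2l => //.
have ln2 := ln2_gt0; rewrite /rho mulrAC ler_pdivlMr //.
by rewrite [(l * _)%N]mulnC mulnA natrM -mulrA ler_wpM2l // ln_size_ge.
Qed.

Lemma output_sound : johnson_sound alpha y k E ->
  forall (c : 'I_k -> 'rV[R]_d) (sigma : d.-tuple bool -> 'I_k),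
    (1 + (1 - alpha) / (z - y)%:R - eps) * (rho * (size P)%:R * ln (size P)%:R)
      <= kmedian_cost P c sigma.
Proof.
move=> hs c sigma; have [hk hE0 hu _] := E_wf.
have h := clustering_sound wf_card wf_cardI y_lt_z hk E_cardz (@sub_used_set _ E) y_gt0 hu hE0
  c sigma hs.
have z2 : (0 < 2 ^ z)%N by rewrite expn_gt0.
rewrite size_map; apply: gap_bound h => //.
- by rewrite subn_gt0.
- by rewrite ltn_subrL y_gt0.
- exact: ltnW s_gt_2z.
- apply: le_trans (_ : K%:R * eps <= _).
    apply: le_trans K_large; rewrite -natrM ler_nat mulnC leq_pmulr //.
  by rewrite ler_pM2r // ler_nat /weight_factor -addnA leq_addr.
- apply: le_trans (_ : K%:R * eps <= _); last by rewrite ler_pM2r // ler_nat K_le_log.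
  by apply: le_trans K_large; rewrite -natrM ler_nat; nia.
(* After scaling by [threshold], [E_large] turns [threshold * (k * n ^ (z - y - 1))] into [size E];
   the rest is at most [3 * z ^ 2 * 2 ^ z] because [(z - y).+1 <= z]. *)
- have hB : 0 < threshold%:R :> R by rewrite ltr0n /threshold addn2.
  rewrite -(ler_pM2r hB).
  apply: le_trans (_ : (3 * z ^ 2 * 2 ^ z)%:R * (size E)%:R <= _).
    rewrite -!natrM ler_nat.
    apply: leq_trans (_ : 3 * z ^ 2 * 2 ^ z * (threshold * (k * n ^ (z - y - 1))) <= _)%N; last first.
      by rewrite leq_mul2l E_large orbT.
    have hz : ((z - y).+1 <= z)%N by rewrite ltn_subrL y_gt0.
    move: (z - y).+1 (n ^ _)%N hz (2 ^ z)%N threshold => a M hz w B.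
    have -> : (a * (k * (w * z * M)) * 3 * B = 3 * z * w * (B * (k * M)) * a)%N by ring.
    have -> : (3 * z ^ 2 * w * (B * (k * M)) = 3 * z * w * (B * (k * M)) * z)%N by ring.
    by rewrite leq_mul2l hz orbT.
  rewrite mulrAC; apply: ler_wpM2r => //.
  apply: le_trans (_ : K%:R * eps <= _).
    by apply: le_trans K_large; rewrite ler_nat -!mulnA leq_mul2r orbT.
  by rewrite mulrC ler_pM2l // ler_nat /threshold -addnA leq_addr.
- by rewrite ln_ge0 // ler1n ltnW // size_gt1.
- exact: ln_size_le.
- by rewrite /kmedian_cost; apply: sumr_ge0 => a _; apply: l1norm_ge0.
Qed.

End LargeInstance.

(** * Hardness, with a table for small universes *)

(** The universe size comes first and in unary, so a constant prefix decides whether it reaches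
    [N0]. *)
Lemma take_unary N n r : 
  ((N <= size (unary n ++ r)) && (take N (unary n ++ r) == nseq N true))%N = (N <= n)%N.
Proof.
rewrite /unary cat_rcons; have [hN|hN] := leqP N n.
  rewrite size_cat size_nseq (leq_trans hN (leq_addr _ _)) /=.
  by rewrite takel_cat ?size_nseq // take_nseq // eqxx.
apply/negP => /andP[_ /eqP e].
have := congr1 (fun u => nth true u n) e.
rewrite nth_take // nth_cat size_nseq ltnn subnn /= nth_nseq hN.
by [].
Qed.

Section Reduction.

Variables (R : realType) (z y : nat) (alpha eps rho gamma D : R) (h : nat -> nat).
Variables (K N0 : nat) (xyes xno : seq bool).

Let s := weight_factor z K.
Let JC := johnson_coverage_star alpha z y h.
Let KM := kmedian_gap rho gamma D.

Hypothesis y_gt0 : (0 < y)%N.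
Hypothesis y_lt_z : (y < z)%N.
Hypothesis alpha_ge0 : 0 <= alpha.
Hypothesis alpha_lt1 : alpha < 1.
Hypothesis eps_gt0 : 0 < eps.
Hypothesis K_large : (6 * z ^ 2 * 2 ^ z)%:R <= K%:R * eps.
Hypothesis D_large : (block_len s z)%:R <= D * ln 2.
Hypothesis rhoE : rho = ((z - y) * s)%:R / ln 2.
Hypothesis gammaE : gamma = 1 + (1 - alpha) / (z - y)%:R - eps.
Hypothesis N0_large : forall m, (N0 <= m)%N -> (threshold K <= h m)%N.
Hypothesis xyesP : yes_instance KM xyes.
Hypothesis xnoP : no_instance KM xno.

Let z_gt0 : (0 < z)%N := leq_ltn_trans (leq0n y) y_lt_z.

Lemma yes_no_disjoint v : yes_instance JC v -> no_instance JC v -> False.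
Proof.
case=> n [k [E [w _ -> [S [hS hc]]]]] [n' [k' [E' [w' _ e hs]]]].
have := johnson_encode_inj z_gt0 (P := fun m k E => johnson_sound alpha y k E) w w' e hs.
move=> /(_ S hS); have -> : count (covers S) E = size E.
  by apply/eqP; rewrite -all_count; apply/allP.
by have [_ hE _ _] := w; rewrite leNgt gtr_pMl ?ltr0n // alpha_lt1.
Qed.

(* A no-instance with [n < N0] has [k < |E| <= 2 ^ n], so its encoding is shorter than this. *)
Definition table_depth : nat := (N0 + 2 ^ N0 + 2 ^ N0 * N0 + 3)%N.

(** The conditions concern the constant [u] rather than the tape, so [no_instance JC u] is settled
    classically when the program is built. *)
Definition leaf (u : seq bool) (ended : bool) : cmd :=
  if (N0 <= size u)%N && (take N0 u == nseq N0 true)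
  then Seq (pushes 0 u) (reduction s (block_len s z))
  else Seq (clear_stack 0)
         (pushes 0 (if ended && `[< no_instance JC u >] then xno else xyes)).

Definition full_reduction : cmd := table leaf table_depth [::].

Definition full_time (m : nat) : nat :=
  (table_depth + 3 * m + 1 + size xno + size xyes + reduction_time s (block_len s z) m
   + 5 * table_depth)%N.

Lemma poly_le_full_time : poly_le full_time.
Proof.
rewrite /full_time; repeat first [exact: poly_le_reduction_time | exact: poly_le_const
  | exact: poly_le_id | apply: poly_le_add | apply: poly_le_mul].
Qed.

Lemma johnson_wf_instance v : yes_instance JC v \/ no_instance JC v ->
  exists n k (E : seq {set 'I_n}), [/\ v = johnson_encode k E, johnson_wf z k E &
   (h n * (k * n ^ (z - y - 1)) <= size E)%N].
Proof. by case=> -[n [k [E [w side -> _]]]]; exists n, k, E. Qed.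

Lemma run_small_instance n k (E : seq {set 'I_n}) (v := johnson_encode k E) : (n < N0)%N ->
  johnson_wf z k E ->
  exists2 st, run full_reduction (input_store v) st (full_time (size v)) &
   (yes_instance JC v -> yes_instance KM (st 0)) /\
   (no_instance JC v -> no_instance KM (st 0)).
Proof.
move=> hn w; pose u := take table_depth v.
pose out := if (size v < table_depth)%N && `[< no_instance JC u >] then xno else xyes.
have hu : ((N0 <= size u)%N && (take N0 u == nseq N0 true)) = false.
  have hN : (N0 <= table_depth)%N by rewrite /table_depth; lia.
  rewrite /u size_take_min take_takel // leq_min hN /=.
  by rewrite /v /johnson_encode take_unary leqNgt hn.
exists (input_store out).
  apply: run_conv.
  - apply: run_table; rewrite cat0s -/u /leaf hu.
    by apply: run_seq; [exact: run_clear_stack | exact: run_pushes].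
  - by apply: funext => -[|i]; rewrite /upd /= ?cats0.
  - have hout : (size out <= size xno + size xyes)%N by rewrite /out; case: ifP => _; lia.
    apply: (@leq_trans (3 * size (drop table_depth v) + 1 + size out + 5 * table_depth)%N).
      exact: leqnn.
    by rewrite size_drop /full_time; clearbody out; lia.
split=> /= hv; rewrite /out.
  case: ifP => // /andP[hsz /asboolP].
  by rewrite /u take_oversize ?(ltnW hsz) // => /(yes_no_disjoint hv).
have hsz : (size v < table_depth)%N.
  case: hv => n' [k' [E' [w' _ e hs]]].
  have := johnson_encode_inj z_gt0 (P := fun m k E => johnson_sound alpha y k E) w w' e hs.
  move=> /(johnson_sound_k_lt y_lt_z alpha_lt1 w) hk.
  have hE := johnson_wf_size_le w.
  have h2 : (2 ^ n <= 2 ^ N0)%N by rewrite leq_exp2l // ltnW.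
  have -> : size v = (n.+1 + k.+1 + size E * n)%N.
    rewrite /v /johnson_encode !size_cat /unary !size_rcons !size_nseq addnA.
    by congr addn; elim: (E) => //= T E'' IH; rewrite size_cat IH size_row_of mulSn.
  have : (size E * n <= 2 ^ N0 * N0)%N.
    by apply: leq_mul; [exact: leq_trans h2 | exact: ltnW].
  by rewrite /table_depth; clear -hk hE h2 hn; lia.
by rewrite hsz /u take_oversize ?(ltnW hsz) //; case: asboolP.
Qed.

Lemma run_large_instance n k (E : seq {set 'I_n}) (v := johnson_encode k E) : (N0 <= n)%N ->
  johnson_wf z k E -> (h n * (k * n ^ (z - y - 1)) <= size E)%N ->
  exists2 st, run full_reduction (input_store v) st (full_time (size v)) &
   (yes_instance JC v -> yes_instance KM (st 0)) /\
   (no_instance JC v -> no_instance KM (st 0)).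
Proof.
move=> hn w side.
have hE : (threshold K * (k * n ^ (z - y - 1)) <= size E)%N.
  by apply: leq_trans side; rewrite leq_mul2r N0_large ?orbT.
have [st hst hrun] := run_reduction_instance w z_gt0 (size_gt1 y_lt_z w hE) (s_gt_2z z K).
pose u := take table_depth v.
have hu : ((N0 <= size u)%N && (take N0 u == nseq N0 true)) = true.
  have hN : (N0 <= table_depth)%N by rewrite /table_depth; lia.
  rewrite /u size_take_min take_takel // leq_min hN /=.
  by rewrite /v /johnson_encode take_unary hn.
exists st.
  apply: run_conv.
  - apply: run_table; rewrite cat0s -/u /leaf hu.
    apply: run_seq; first exact: run_pushes.
    rewrite (_ : upd _ _ _ = input_store v); first exact: hrun.
    by apply: funext => -[|i]; rewrite /upd //= cat_take_drop.
  - by [].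
  - rewrite /full_time -/s -/v size_take_min.
    by have := geq_minl table_depth (size v); lia.
have wf := output_wf y_lt_z w hE; have hd := output_dim y_lt_z w hE D_large.
split=> -[n' [k' [E' [w' _ e hJ]]]]; rewrite hst;
    exists (code_len s z E), k, (map (point (@word_of s z n E)) E); split=> //.
  have := johnson_encode_inj z_gt0 (P := fun m k E => johnson_complete y k E) w w' e hJ.
  by rewrite rhoE => hc; exact: (output_complete R y_lt_z w hE hc).
have := johnson_encode_inj z_gt0 (P := fun m k E => johnson_sound alpha y k E) w w' e hJ.
rewrite rhoE gammaE => hs.
exact: (output_sound y_gt0 y_lt_z alpha_ge0 alpha_lt1 eps_gt0 K_large w hE hs).
Qed.

Lemma NP_hard_reduction : NP_hard JC -> NP_hard KM.
Proof.
move=> hard L /hard[f [hf hL]].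
have hx x : exists st, run full_reduction (input_store (f x)) st (full_time (size (f x))) /\
    ((L x -> yes_instance KM (st 0)) /\ (~ L x -> no_instance KM (st 0))).
  (* A many-one reduction always lands in the promise, so the program only ever meets well-formed
     encodings. *)
  have hyn : yes_instance JC (f x) \/ no_instance JC (f x).
    by have [h1 h2] := hL x; case: (EM (L x)) => hLx; [left; apply: h1 | right; apply: h2].
  have [n [k [E [e w side]]]] := johnson_wf_instance hyn; rewrite e in hyn hL *.
  have [hn|hn] := leqP N0 n.
    have [st h1 [h2 h3]] := run_large_instance hn w side; exists st; split => //.
    by have := hL x; rewrite e => -[h4 h5]; split => [/h4/h2|/h5/h3].
  have [st h1 [h2 h3]] := run_small_instance hn w; exists st; split => //.
  by have := hL x; rewrite e => -[h4 h5]; split => [/h4/h2|/h5/h3].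
have [st hst] := choice hx.
exists (fun x => st x 0); split; last by move=> x; exact: (hst x).2.
by apply: (poly_time_post hf poly_le_full_time) => x; exists (st x) => //; apply: (hst x).1.
Qed.

End Reduction.

Theorem theorem3p22 (R : realType) (z y : nat) (alpha : R)
    (y_ge1 : (1 <= y)%N) (y_lt_z : (y < z)%N)
    (alpha_ge0 : 0 <= alpha) (alpha_lt1 : alpha < 1)
    (JC_hard : johnson_coverage_star_NP_hard alpha z y) :
  forall eps : R, 0 < eps ->
  exists rho : R, 0 < rho /\
  exists D : R,
    NP_hard (kmedian_gap rho (1 + (1 - alpha) / (z - y)%:R - eps) D).
Proof.
move=> eps eps_gt0; have [h [h_infty hard]] := JC_hard.
have ln2 := ln2_gt0 R.
pose K := Num.bound ((6 * z ^ 2 * 2 ^ z)%:R / eps).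
have hK : (6 * z ^ 2 * 2 ^ z)%:R <= K%:R * eps.
  by rewrite -ler_pdivrMr // ltW // archi_boundP // divr_ge0 // ltW.
pose s := weight_factor z K.
pose rho : R := ((z - y) * s)%:R / ln 2.
pose gamma := 1 + (1 - alpha) / (z - y)%:R - eps.
have rho_gt0 : 0 < rho.
  by rewrite divr_gt0 // ltr0n muln_gt0 subn_gt0 y_lt_z /s /weight_factor addn1.
exists rho; split; first exact: rho_gt0.
(* The dimension of the constant no-instance. [D] must accommodate it as well as the output of the
   reduction, and the successor yields the [1 <= D * ln 2] wanted by the yes-instance. *)
pose d := (Num.bound `|gamma * (rho * 2 * ln 2)|).+1.
have hd : gamma * (rho * 2 * ln 2) <= d%:R.
  apply: le_trans (ler_norm _) (le_trans (ltW (archi_boundP (normr_ge0 _))) _).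
  by rewrite ler_nat.
pose D : R := (block_len s z + d)%:R / ln 2.
exists D.
have hD : D * ln 2 = (block_len s z + d)%:R by rewrite divfK // gt_eqF.
have [N0 hN0] := h_infty (threshold K).
have [xyes hyes] : exists x, yes_instance (kmedian_gap rho gamma D) x.
  by apply: kmedian_yes_instance; rewrite ?(ltW rho_gt0) // hD ler1n addnS.
have [xno hno] : exists x, no_instance (kmedian_gap rho gamma D) x.
  by apply: (@kmedian_no_instance _ _ _ _ d) => //; rewrite hD ler_nat leq_addl.
apply: (NP_hard_reduction y_ge1 y_lt_z alpha_ge0 alpha_lt1 eps_gt0 hK _ _ _ hN0 hyes hno hard) => //.
by rewrite hD ler_nat leq_addr.
Qed.
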